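(* Consider Hawkes$/GI/1$ queues with Hawkes parameters $(\lambda_0,m,f)$, job size $V$ and service rate $\mu\in[\underline\mu,\bar\mu]$, where for some $\varepsilon>0$, $\underline\mu>0$ one has $\lambda_0\mathbb{E}[V]/(1-m)<\underline\mu-\varepsilon$; the birth time $b$ has continuous density $f$ and $\mathbb{E}[\exp(\theta b)]<\infty$ for some $\theta>0$; and $V$ has a finite moment generating function in a neighborhood of the origin. Then there exist two positive constants $\eta,\theta>0$ (depending only on the model parameters) such that for any two such queues with initial states $(W^i(0),X^i(0),N_0^i(0))$, $i=1,2$, that are semi-synchronously coupled, for all $p\ge1$ and $t\ge 0$, $$\mathbb{E}\big[|W^1(t)-W^2(t)|^p\,\big|\,\mathcal{F}_0\big]\le D_0^p\sum_{i=1}^2\exp\Big(-\big(\eta\mu t-(\eta+2\theta)\mu L_0^i-\theta(W^i(0)+J_0^i(0))\big)_+\Big)$$ and $$\mathbb{E}\big[|X^1(t)-X^2(t)|^p\,\big|\,\mathcal{F}_0\big]\le \big(X^1(0)+X^2(0)+t\big)^p\sum_{i=1}^2\exp\Big(-\big(\eta\mu t-(\eta+2\theta)\mu L_0^i-\theta(W^i(0)+J_0^i(0))\big)_+\Big),$$ where $D_0=|W^1(0)-W^2(0)|+\max(J_0^1(0),J_0^2(0))$.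
   Context: Hawkes arrivals with parameters $(\lambda_0,m,f)$ ($\lambda_0>0$, $0<m<1$, $h=mf$): immigrants arrive as a Poisson process of rate $\lambda_0$; immigrant $l$ starts a cluster $C_l$ in which the immigrant is event $1$ and every event $k$, with arrival time $t_l^k$, independently generates children at the points of a Poisson process on $[t_l^k,\infty)$ with rate $h(t-t_l^k)$. Clusters relative to immigrant times are i.i.d. and independent of immigrant times. Delays between events and their parents (''birth times'') have density $f$; $b$ is a generic one. Event $k$ of $C_l$ is written $(k,t_l^k,p_l^k,V_l^k)$, with $p_l^k$ the index of its parent ($0$ for the immigrant) and $V_l^k$ its job size; job sizes are i.i.d. copies of a positive random variable $V$ with continuous density and $\mathbb{E}[V]=1$, independent of arrival times. $\delta_l=\max_k t_l^k$ is the departure time of the cluster. Hawkes memory at time $t$: $N_0(t)$ is the set of all events belonging to clusters with $t_l^1<t$ and $\delta_l\ge t$. Two systems $i=1,2$ with the same $\mu$, having initial workload $W^i(0)\ge 0$, initial observed busy time $X^i(0)\ge0$ and Hawkes memory $N_0^i(0)$, are semi-synchronously coupled if they share all clusters (arrival times and job sizes) whose immigrant arrives after time $0$; these shared clusters are independent of $\mathcal{F}_0=\sigma(W^i(0),X^i(0),N_0^i(0),i=1,2)$. System $i$ in addition receives the jobs in $N_0^i(0)$ arriving at times $\ge0$. With $R^i(t)$ the total size of jobs arriving to system $i$ in $[0,t)$ minus $\mu t$, $$W^i(t)=W^i(0)+R^i(t)-0\wedge\min_{0\le s\le t}\{W^i(0)+R^i(s)\}.$$ The observed busy period is $X^i(t)=t-\sup\{s\le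 t: W^i(s)=0\}$, i.e. the time elapsed since the server was last idle (equal to $X^i(0)+t$ if $W^i$ does not vanish on $[0,t]$). Total residual job size: $J_0^i(0)=\sum V_l^k$ over events of $N_0^i(0)$ with $t_l^k\ge0$. Residual lifetime: $L_0^i=\max\{t_l^k:(k,t_l^k,p_l^k,V_l^k)\in N_0^i(0)\}$, taken as $0$ if $N_0^i(0)$ is empty. $(x)_+=\max(x,0)$. *)

(* Defs.v *)
From HB Require Import structures.
From mathcomp Require Import all_boot all_order all_algebra.
From mathcomp Require Import all_classical all_reals all_analysis.
From mathcomp Require Import measurable_realfun.

Set Implicit Arguments.
Unset Strict Implicit.
Unset Printing Implicit Defensive.

Import Order.TTheory GRing.Theory Num.Theory.
Import numFieldNormedType.Exports.

Local Open Scope classical_set_scope.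
Local Open Scope ring_scope.

Section Probability.
Context {d : measure_display} {T : measurableType d} {R : realType}.
Variable P : probability T R.

Definition sigma_of {dS : measure_display} {S : measurableType dS} {I : Type}
    (Y : I -> T -> S) : set (set T) :=
  <<s \bigcup_i preimage_set_system setT (Y i) measurable >>.

Definition mutually_independent {I : Type} (F : I -> set (set T)) : Prop :=
  forall (n : nat) (s : 'I_n -> I) (E : 'I_n -> set T),
    injective s -> (forall k, F (s k) (E k)) ->
    P (\bigcap_(k in setT) E k) = (\prod_(k < n) P (E k))%E.

(* Z is a version of the conditional expectation E[Y | G], for Y >= 0;
   both sides may be +oo *)
Definition cond_expectation_version (G : set (set T)) (Y Z : T -> \bar R) :
    Prop :=
  (forall B : set (\bar R), measurable B -> G (Z @^-1` B)) /\
  (forall A, G A -> (\int[P]_(w in A) Z w = \int[P]_(w in A) Y w)%E).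

Definition cond_expectation_le (G : set (set T)) (Y B : T -> \bar R) : Prop :=
  forall Z, cond_expectation_version G Y Z ->
    {ae P, forall w, (Z w <= B w)%E}.

Definition has_density (X : {RV P >-> R}) (g : R -> R) : Prop :=
  [/\ measurable_fun setT g, (forall x, 0 <= g x) &
      forall B : set R, measurable B ->
        distribution P X B = (\int[lebesgue_measure]_(x in B) (g x)%:E)%E].

(* A random set of points of the real line is enumerated by a sequence of
   extended real variables; an infinite value means that there is no point
   with this label. *)
Definition nb_points (X : nat -> T -> \bar R) (B : set R) (w : T) : \bar R :=
  counting [set j : nat | (EFin @` B) (X j w)].

(* The mass at n is written out because the library's poisson_pmf is not the
   Dirac mass at 0 when the parameter is 0. *)
Definition poisson_process (X : nat -> T -> \bar R) (rate : R -> R) : Prop :=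
  [/\ forall j, measurable_fun setT (X j),
      forall B : set R, measurable B ->
        (\int[lebesgue_measure]_(x in B) (rate x)%:E < +oo)%E ->
        let a := fine (\int[lebesgue_measure]_(x in B) (rate x)%:E)%E in
        forall n : nat, P [set w | nb_points X B w = n%:R%:E] =
          (expR (- a) * a ^+ n / n`!%:R)%:E
    & forall (n : nat) (B : 'I_n -> set R),
        (forall k, measurable (B k)) -> trivIset setT B ->
        mutually_independent
          (fun k : 'I_n => sigma_of (fun _ : unit => nb_points X (B k)))].

End Probability.

Section InitialState.
Context {R : realType}.

Record event := Event { ev_time : R; ev_parent : nat; ev_job : R }.

(* A cluster of the memory lists its events; the event at position k has
   index k.+1. *)
Definition event_list := seq event.

Definition ev (c : event_list) (k : nat) : event := nth (Event 0 0 0) c k.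

Definition departure (c : event_list) : R :=
  \big[Num.max/ev_time (ev c 0)]_(e <- c) ev_time e.

(* a cluster that belongs to a Hawkes memory at time 0 *)
Definition memory_cluster (c : event_list) : Prop :=
  [/\ (0 < size c)%N,
      ev_parent (ev c 0) = 0%N /\ ev_time (ev c 0) < 0,
      forall k, (0 < k < size c)%N ->
        (0 < ev_parent (ev c k) <= k)%N /\
        ev_time (ev c (ev_parent (ev c k)).-1) <= ev_time (ev c k),
      forall k, (k < size c)%N -> 0 < ev_job (ev c k)
    & 0 <= departure c].

Record state := State {
  workload0 : R;
  busy0 : R;
  memory0 : seq event_list }.

Definition valid_state (s : state) : Prop :=
  [/\ 0 <= workload0 s, 0 <= busy0 s
    & forall l, (l < size (memory0 s))%N ->
        memory_cluster (nth [::] (memory0 s) l)].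

Definition residual_job_size (s : state) : R :=
  \sum_(e <- flatten (memory0 s) | 0 <= ev_time e) ev_job e.

(* The unit 0 of the maximum is harmless on valid states: every cluster of
   the memory departs at a time >= 0. *)
Definition residual_lifetime (s : state) : R :=
  \big[Num.max/0]_(e <- flatten (memory0 s)) ev_time e.

(* real coordinates that determine a state *)
Inductive coordinate :=
  | Workload | BusyTime | NbClusters | NbEvents of nat
  | EvTime of nat & nat | EvParent of nat & nat | EvJob of nat & nat.

Definition state_coord (c : coordinate) (s : state) : R :=
  match c with
  | Workload => workload0 s
  | BusyTime => busy0 s
  | NbClusters => (size (memory0 s))%:R
  | NbEvents l => (size (nth [::] (memory0 s) l))%:R
  | EvTime l k => ev_time (ev (nth [::] (memory0 s) l) k)
  | EvParent l k => (ev_parent (ev (nth [::] (memory0 s) l) k))%:R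
  | EvJob l k => ev_job (ev (nth [::] (memory0 s) l) k)
  end.

End InitialState.

Arguments event : clear implicits.
Arguments event_list : clear implicits.
Arguments state : clear implicits.

Section Queue.
Context {d : measure_display} {T : measurableType d} {R : realType}.
Variable P : probability T R.

(* The clusters whose immigrant arrives after time 0. Cluster l carries one
   potential event for every word u : seq nat; [::] is the immigrant and
   j :: u is the j-th child of u. The births of the children of u, counted
   from the arrival of u, are the points of offspring l u. *)
Record clusters := Clusters {
  immigrant : nat -> T -> \bar R;
  offspring : nat -> seq nat -> nat -> T -> \bar R;
  jobsize : nat -> seq nat -> {RV P >-> R} }.

(* infinite when u is not an event of cluster l *)
Fixpoint arrival (C : clusters) (l : nat) (u : seq nat) (w : T) : \bar R :=
  if u is j :: v then (arrival C l v w + offspring C l v j w)%E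
  else immigrant C l w.

Definition shared_work (C : clusters) (t : R) (w : T) : \bar R :=
  (\esum_(lu in [set: nat * seq nat])
    if (0%:E <= arrival C lu.1 lu.2 w < t%:E)%E
    then (jobsize C lu.1 lu.2 w)%:E else 0%:E)%E.

Definition memory_work (s : state R) (t : R) : R :=
  \sum_(e <- flatten (memory0 s) | 0 <= ev_time e < t) ev_job e.

(* shared_work is almost surely finite; fine only selects its real value. *)
Definition net_input (mu : R) (C : clusters) (S : T -> state R) (t : R)
    (w : T) : R :=
  fine (shared_work C t w) + memory_work (S w) t - mu * t.

(* s |-> W(0) + R(s) is left-continuous with upward jumps, so that the
   infimum is attained. *)
Definition workload (mu : R) (C : clusters) (S : T -> state R) (t : R)
    (w : T) : R :=
  let W0 := workload0 (S w) in
  W0 + net_input mu C S t w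
  - Num.min 0 (inf [set W0 + net_input mu C S s w | s in `[0, t]]).

Definition observed_busy (mu : R) (C : clusters) (S : T -> state R) (t : R)
    (w : T) : R :=
  let idle := [set s | s \in `[0, t] /\ workload mu C S s w = 0] in
  if `[< idle !=set0 >] then t - sup idle else busy0 (S w) + t.

Definition F0 (S : 'I_2 -> T -> state R) : set (set T) :=
  sigma_of (fun (ic : 'I_2 * coordinate) w => state_coord ic.2 (S ic.1 w)).

(* The independent ingredients: the initial data, the immigrants, the births
   from each potential event, and the job sizes. *)
Inductive source :=
  | Initial | Immigrants | Offspring of nat & seq nat
  | JobSize of nat & seq nat.

Definition source_sigma (C : clusters) (S : 'I_2 -> T -> state R)
    (i : source) : set (set T) :=
  match i with
  | Initial => F0 S
  | Immigrants => sigma_of (immigrant C)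
  | Offspring l u => sigma_of (offspring C l u)
  | JobSize l u => sigma_of (fun _ : unit => jobsize C l u : T -> R)
  end.

Record semi_synchronously_coupled (lambda0 m : R) (f : R -> R)
    {d' : measure_display} {O : measurableType d'} (Q : probability O R)
    (V : {RV Q >-> R}) (C : clusters) (S : 'I_2 -> T -> state R) : Prop := {
  ssc_measurable : forall i c, measurable_fun setT (fun w => state_coord c (S i w));
  ssc_valid : forall i w, valid_state (S i w);
  ssc_immigrant :
    poisson_process P (immigrant C) (cst lambda0 \_ `[0, +oo[);
  ssc_offspring : forall l u,
    poisson_process P (offspring C l u) ((fun x => m * f x) \_ `[0, +oo[);
  ssc_jobsize : forall l u (B : set R), measurable B ->
    distribution P (jobsize C l u) B = distribution Q V B;
  ssc_independent : mutually_independent P (source_sigma C S) }.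

(* the common sum of exponentials of the two bounds *)
Definition decay_bound (mu eta theta : R) (S : 'I_2 -> T -> state R) (t : R)
    (w : T) : R :=
  \sum_(i < 2) expR (- Num.max
    (eta * mu * t - (eta + 2 * theta) * mu * residual_lifetime (S i w)
      - theta * (workload0 (S i w) + residual_job_size (S i w))) 0).

Definition initial_gap (S : 'I_2 -> T -> state R) (w : T) : R :=
  `|workload0 (S 0 w) - workload0 (S 1 w)|
  + Num.max (residual_job_size (S 0 w)) (residual_job_size (S 1 w)).

End Queue.

(* Main.v *)
Require Import Defs.
From HB Require Import structures.
From mathcomp Require Import all_boot all_order all_algebra.
From mathcomp Require Import all_classical all_reals all_analysis.
From mathcomp Require Import measurable_realfun.
From mathcomp Require Import lra zify ring.

(* Write A(t) for the shared work arriving in [0, t), and W, J, L for the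
   initial workload, the residual job size and the residual lifetime of a
   system. Both workloads are reflections of inputs that differ only by the
   memory work, so their gap never exceeds D_0. If
   W + J + mu L + A(t) - mu t < 0 for a system, its reflected input attains its
   minimum after L, and its workload at t is that of a system which starts
   empty and receives only the shared work. If this holds for both systems, they
   have coupled, and they were idle at a common time, so that their observed
   busy times agree too.
   By Chernoff's bound the complementary event has conditional probability at
   most exp(theta (W + J + mu L - mu t)) E[exp(theta A(t))], as A is independent
   of the initial data. Peeling off the clusters generation by generation gives
   E[exp(theta A(t))] <= exp(lambda0 t (x - 1)) as soon as
   E[exp(theta V)] exp(m (x - 1)) <= x; by stability, x = 1 + c theta with
   c = (mu_lo - eps) / lambda0 > 1 / (1 - m) is admissible for small theta. *)

Set Implicit Arguments.
Unset Strict Implicit.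
Unset Printing Implicit Defensive.

Import Order.TTheory GRing.Theory Num.Theory.
Import numFieldNormedType.Exports.

Local Open Scope classical_set_scope.
Local Open Scope ring_scope.

(** * Independent families of sigma-algebras *)

(** On each path the gap of a system pair is 0 once both have coupled and at most [D_0] (or the sum
    of the busy times plus [t]) otherwise, so every power [p] is paid with the same probability and
    the constants do not depend on [p]. Conditioning is done by testing. The workloads are not shown
    to be measurable and the bound must hold for every version of the conditional expectation, so
    the proof builds a measurable majorant [Psi] of [exp(theta A(t))] with [E[xi Psi] <= E[xi] M]
    for all [xi >= 0] measurable for [F0]. The gap is then dominated by an affine function of [Psi]
    with coefficients measurable for [F0], which is integrated over sets of [F0]. [A(t)] is an
    infinite sum over words; it is approached by finite truncations that count whole clusters,
    including the work that arrives after [t]. This overcount makes the recursion over generations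
    close. The positive part in the exponent is a minimum with 1: on the event of [F0] where
    Chernoff's bound exceeds 1, the trivial bound is used. *)

Section Independence.
Context {d : measure_display} {T : measurableType d} {R : realType}.
Variable P : probability T R.
Context {I : choiceType}.
Variable F : I -> set (set T).
Hypothesis F_sigma : forall i, sigma_algebra setT (F i).
Hypothesis F_meas : forall i, F i `<=` measurable.
Hypothesis F_indep : mutually_independent P F.

(** A pi-system that generates the same sigma-algebra as the union [joint J]. Sets [E i] with [i]
    outside [s] are irrelevant, so [E] can be total. *)
Definition boxes (J : set I) : set (set T) :=
  [set A | exists (s : seq I) (E : I -> set T),
    [/\ uniq s, [set` s] `<=` J, (forall i, F i (E i)) &
        A = \bigcap_(i in [set` s]) E i]].

Definition joint (J : set I) : set (set T) := \bigcup_(i in J) F i.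

Let FT i : F i setT.
Proof. by have [F0 FC _] := F_sigma i; rewrite -(setD0 setT); exact: FC. Qed.

Let FI i A B : F i A -> F i B -> F i (A `&` B).
Proof.
move=> FA FB; have [F0 FC FU] := F_sigma i.
rewrite -(setCK (A `&` B)) setCI -!setTD; apply: (FC).
have -> : (setT `\` A) `|` (setT `\` B) =
    \bigcup_n (if n == 0%N then setT `\` A else setT `\` B).
  rewrite predeqE => x; split=> [[xA|xB]|[n _]].
  - by exists 0%N.
  - by exists 1%N.
  - by case: ifP => _ ?; [left|right].
by apply: FU => n; case: ifP => _; exact: FC.
Qed.

Lemma probability_bigcap (s : seq I) (E : I -> set T) :
  uniq s -> (forall i, F i (E i)) ->
  P (\bigcap_(i in [set` s]) E i) = (\prod_(i <- s) P (E i))%E.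
Proof.
move=> us FE; pose t := tnth (in_tuple s).
have t_inj : injective t by apply/tuple_uniqP.
have := F_indep (s := t) (E := fun k => E (t k)) t_inj (fun k => FE _).
rewrite -(big_tnth _ _ s xpredT (fun i => P (E i))) => <-; congr (P _).
rewrite predeqE => x; split=> h i /= si; first by apply: h; exact: mem_tnth.
by have /(tnthP (in_tuple s))[k ->] : i \in in_tuple s by []; exact: h.
Qed.

Lemma setI_closed_boxes J : setI_closed (boxes J).
Proof.
move=> _ _ [s [E [us sJ FE ->]]] [s' [E' [us' sJ' FE' ->]]].
exists (undup (s ++ s')), (fun i => (if i \in s then E i else setT) `&`
                                   (if i \in s' then E' i else setT)).
split; first exact: undup_uniq.
- by move=> i /=; rewrite mem_undup mem_cat => /orP[/sJ|/sJ'].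
- by move=> i; apply: FI; case: ifP.
rewrite predeqE => x; split=> [[sx s'x] i _|h].
  by split; case: ifP => // si; [exact: sx|exact: s'x].
split=> i /= si.
  have [] := h i; first by rewrite /= mem_undup mem_cat si.
  by rewrite si.
have [] := h i; first by rewrite /= mem_undup mem_cat si orbT.
by rewrite si.
Qed.

Lemma boxesT J : boxes J setT.
Proof.
by exists [::], (fun=> setT); split => //; rewrite predeqE => x; split => // _ i.
Qed.

Lemma boxes_measurable J : boxes J `<=` measurable.
Proof.
move=> _ [s [E [_ _ FE ->]]].
by rewrite bigcap_seq; apply: bigsetI_measurable => i _; exact/F_meas/FE.
Qed.

Lemma joint_boxes J : joint J `<=` boxes J.
Proof.
move=> A [i Ji FA].
exists [:: i], (fun j => if j == i then A else setT); split => //.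
- by move=> j /=; rewrite inE => /eqP ->.
- by move=> j; case: eqP => [->|].
rewrite predeqE => x; split=> [Ax j|/(_ i)]; rewrite /= ?inE.
  by case: eqP.
by rewrite eqxx; exact.
Qed.

Lemma independent_boxes J J' A B : J `&` J' = set0 ->
  boxes J A -> boxes J' B -> P (A `&` B) = (P A * P B)%E.
Proof.
move=> JJ' [s [E [us sJ FE ->]]] [s' [E' [us' sJ' FE' ->]]].
have disj i : i \in s -> i \in s' -> False.
  by move=> /sJ Ji /sJ' J'i; have : (J `&` J') i by []; rewrite JJ'.
have uss' : uniq (s ++ s').
  rewrite cat_uniq us us' andbT /=; apply/hasPn => i s'i.
  by apply/negP => si; exact: (disj i).
pose E'' i := if i \in s then E i else E' i.
have FE'' i : F i (E'' i) by rewrite /E''; case: ifP.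
rewrite (probability_bigcap us FE) (probability_bigcap us' FE').
have := probability_bigcap uss' FE''; rewrite big_cat/=.
have -> : (\prod_(i <- s) P (E'' i) = \prod_(i <- s) P (E i))%E.
  by apply: eq_big_seq => i si; rewrite /E'' si.
have -> : (\prod_(i <- s') P (E'' i) = \prod_(i <- s') P (E' i))%E.
  apply: eq_big_seq => i si; rewrite /E''; case: ifP => // s'i.
  by case: (disj i).
move=> <-; congr (P _); rewrite predeqE => x; split=> [[sx s'x] i|h].
  rewrite /= mem_cat /E''; case: ifP => [si _|_ /= s'i]; first exact: sx.
  exact: s'x.
split=> i /= si.
  by have := h i; rewrite /= mem_cat si /E'' si; exact.
have := h i; rewrite /= mem_cat si orbT /E''; case: ifP => [s'i|_]; last exact.
by case: (disj i).
Qed.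

(** Both [A |-> P (A & B)] and [A |-> P A * P B] are finite measures, and they agree on the
    pi-system [G]; uniqueness of measures extends this to the generated sigma-algebra. *)
Lemma independent_sigma (G : set (set T)) (B : set T) :
  setI_closed G -> G setT -> G `<=` measurable -> measurable B ->
  (forall A, G A -> P (A `&` B) = (P A * P B)%E) ->
  forall A, <<s G >> A -> P (A `&` B) = (P A * P B)%E.
Proof.
move=> GI GT mG mB GB A sGA.
have PBge0 : 0 <= fine (P B) by exact: fine_ge0.
pose r : {nonneg R} := NngNum PBge0.
have PAB X : (mscale r P X = P X * P B)%E.
  by rewrite /mscale /= fineK ?fin_num_measure// muleC.
pose m1 : {measure set T -> \bar R} := mrestr P mB.
pose m2 : {measure set T -> \bar R} := mscale r P.
rewrite -PAB -[LHS]/(m1 A) -[RHS]/(m2 A).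
apply: (@g_sigma_algebra_measure_unique _ _ _ G mG (fun=> setT) _ _ m1 m2 GI).
- by [].
- by rewrite bigcup_const //; exists 0%N.
- by move=> X GX; rewrite [LHS]GB// [RHS]PAB.
- by move=> _; apply: (le_lt_trans (probability_le1 P _)); rewrite ?ltry//;
  exact: measurableI.
- exact: sGA.
Qed.

(** The extension from boxes to sigma-algebras is made one argument at a time. *)
Lemma independent_joint J J' A B : J `&` J' = set0 ->
  <<s joint J >> A -> <<s joint J' >> B -> P (A `&` B) = (P A * P B)%E.
Proof.
have sub K C : <<s joint K >> C -> <<s boxes K >> C.
  by apply: sub_smallest2r => //; exact: joint_boxes.
move=> JJ' /sub sA /sub sB.
have mA : measurable A.
  by apply: (smallest_sub _ (@boxes_measurable J)) sA; exact: sigma_algebra_measurable.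
move: A mA sA; suff : forall A, boxes J A -> P (A `&` B) = (P A * P B)%E.
  move=> h A mA; apply: independent_sigma => //.
  - exact: setI_closed_boxes.
  - exact: boxesT.
  - exact: boxes_measurable.
  - by apply: (smallest_sub _ (@boxes_measurable J')) sB;
    exact: sigma_algebra_measurable.
move=> A JA; rewrite setIC muleC; apply: (independent_sigma _ _ _ _ _ sB).
- exact: setI_closed_boxes.
- exact: boxesT.
- exact: boxes_measurable.
- exact: (boxes_measurable JA).
- move=> C J'C; apply: independent_boxes J'C JA; by rewrite setIC.
Qed.

End Independence.

Section IndependentProduct.
Context {d : measure_display} {T : measurableType d} {R : realType}.
Variable P : probability T R.
Local Open Scope ereal_scope.

(** Give two copies of [T] the two sub-sigma-algebras. Independence says exactly that the law of
    [w |-> (w, w)] on their product is the product of the marginal laws, so that Tonelli's theorem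
    separates the integral. *)
Lemma expectation_independent_mul (G H : set (set T)) (Y Z : T -> \bar R) :
  <<s G >> `<=` measurable -> <<s H >> `<=` measurable ->
  (forall A B, <<s G >> A -> <<s H >> B -> P (A `&` B) = P A * P B) ->
  measurable_fun (setT : set (g_sigma_algebraType G)) Y ->
  measurable_fun (setT : set (g_sigma_algebraType H)) Z ->
  (forall w, 0 <= Y w) -> (forall w, 0 <= Z w) ->
  \int[P]_w (Y w * Z w) = \int[P]_w Y w * \int[P]_w Z w.
Proof.
move=> Gm Hm GH mY mZ Y0 Z0.
pose T1 : measurableType _ := g_sigma_algebraType G.
pose T2 : measurableType _ := g_sigma_algebraType H.
have mi1 : measurable_fun setT (id : T -> T1).
  by move=> _ A mA; rewrite setTI; exact: Gm.
have mi2 : measurable_fun setT (id : T -> T2).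
  by move=> _ A mA; rewrite setTI; exact: Hm.
pose i1 : {mfun T >-> T1} := HB.pack (id : T -> T1) (isMeasurableFun.Build _ _ _ _ _ mi1).
pose i2 : {mfun T >-> T2} := HB.pack (id : T -> T2) (isMeasurableFun.Build _ _ _ _ _ mi2).
have mphi : measurable_fun setT (fun w : T => ((w : T1), (w : T2))).
  exact: (measurable_fun_pair mi1 mi2).
pose phi : {mfun T >-> (T1 * T2)%type} :=
  HB.pack (fun w : T => ((w : T1), (w : T2))) (isMeasurableFun.Build _ _ _ _ _ mphi).
pose m1 := distribution P i1; pose m2 := distribution P i2.
pose m' := distribution P phi.
have m'E X : measurable X -> (m1 \x m2) X = m' X.
  apply: product_measure_unique => A B mA mB.
  by rewrite -[RHS]GH.
pose f (p : (T1 * T2)%type) := Y p.1 * Z p.2.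
have mf : measurable_fun setT f.
  by apply: emeasurable_funM; [exact: (measurableT_comp mY measurable_fst)|
     exact: (measurableT_comp mZ measurable_snd)].
have f0 p : 0 <= f p by rewrite mule_ge0.
have -> : \int[P]_w (Y w * Z w) = \int[m']_p f p.
  by rewrite ge0_integral_pushforward.
have -> : \int[m']_p f p = \int[m1 \x m2]_p f p.
  by apply: eq_measure_integral => X mX _; apply: esym; exact: m'E.
rewrite fubini_tonelli1//.
have EY : \int[m1]_x Y x = \int[P]_w Y w.
  by rewrite ge0_integral_pushforward.
have EZ : \int[m2]_x Z x = \int[P]_w Z w.
  by rewrite ge0_integral_pushforward.
have -> : \int[m1]_x \int[m2]_y f (x, y) = \int[m1]_x (Y x * \int[m2]_y Z y).
  by apply: eq_integral => x _; rewrite /f /= ge0_integralZl.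
by rewrite ge0_integralZr ?integral_ge0// EY EZ.
Qed.

End IndependentProduct.

(** * Poisson counts *)

Section Measurability.
Context {d : measure_display} {T : measurableType d} {R : realType}.

Lemma measurable_fun_sub_sigma (G H : set (set T)) {d' : measure_display}
    {S : measurableType d'} (f : T -> S) : G `<=` <<s H >> ->
  measurable_fun (setT : set (g_sigma_algebraType G)) f ->
  measurable_fun (setT : set (g_sigma_algebraType H)) f.
Proof.
move=> GH mf _ B mB; have := mf measurableT B mB; apply: smallest_sub => //.
exact: smallest_sigma_algebra.
Qed.

Lemma measurable_fun_from_sigma (G : set (set T)) {d' : measure_display}
    {S : measurableType d'} (f : T -> S) : G `<=` measurable ->
  measurable_fun (setT : set (g_sigma_algebraType G)) f -> measurable_fun setT f.
Proof.
move=> Gm mf _ B mB; have := mf measurableT B mB; apply: smallest_sub => //.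
exact: sigma_algebra_measurable.
Qed.

Lemma measurable_fun_if_mem {d' : measure_display} {S : measurableType d'}
    (A : set S) (f g : S -> R) : measurable A ->
  measurable_fun setT f -> measurable_fun setT g ->
  measurable_fun setT (fun w => if w \in A then f w else g w).
Proof.
move=> mA mf mg; apply: measurable_fun_if => //.
- by apply: (measurable_fun_bool true); rewrite setTI preimage_mem_true.
- exact: measurable_funS mf.
- exact: measurable_funS mg.
Qed.

End Measurability.

Section PoissonCount.
Context {d : measure_display} {T : measurableType d} {R : realType}.
Variable P : probability T R.
Variables (X : nat -> T -> \bar R) (B : set R) (a : R).
Hypothesis mX : forall j, measurable_fun setT (X j).
Hypothesis mB : measurable B.
Hypothesis a_ge0 : 0 <= a.
Hypothesis X_poisson : forall n : nat,
  P [set w | nb_points X B w = n%:R%:E] = (expR (- a) * a ^+ n / n`!%:R)%:E.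

Lemma measurable_point_in j : measurable (X j @^-1` (EFin @` B)).
Proof.
by rewrite -[X in measurable X]setTI; apply: mX => //;
  exact: measurable_image_EFin.
Qed.

Lemma measurable_nb_points : measurable_fun setT (nb_points X B : T -> \bar R).
Proof.
rewrite (_ : nb_points X B = fun w =>
    (\sum_(j <oo) (\1_(X j @^-1` (EFin @` B)) w)%:E)%E); last first.
  by apply/funext => w; rewrite /nb_points counting_dirac.
apply: ge0_emeasurable_sum => [k w _ _|k _]; first by rewrite lee_fin.
by apply/measurable_EFinP/measurable_indic; exact: measurable_point_in.
Qed.

(** The probability generating function of the Poisson law. At [x = 1] it gives total mass 1. *)
Lemma poisson_series (x : R) :
  (\sum_(n <oo) (x ^+ n * (expR (- a) * a ^+ n / n`!%:R))%:E =
   (expR (- a) * expR (x * a))%:E)%E.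
Proof.
have -> : (fun k => \sum_(0 <= n < k) (x ^+ n * (expR (- a) * a ^+ n / n`!%:R))%:E)%E
   = EFin \o (fun k => expR (- a) * series (exp_coeff (x * a)) k).
  apply/funext => k /=; rewrite sumEFin; congr EFin.
  rewrite /series/= mulr_sumr; apply: eq_bigr => n _.
  by rewrite /exp_coeff/= exprMn !mulrA; congr (_ / _); rewrite mulrAC mulrC mulrA.
have h : (fun k => expR (- a) * series (exp_coeff (x * a)) k) @ \oo -->
    expR (- a) * expR (x * a).
  by apply: cvgMr; exact: is_cvg_series_exp_coeff.
by rewrite EFin_lim ?(cvg_lim _ h)//; exact: cvgP h.
Qed.

(** The product sees only the labels below [K]; the remaining points could only increase the power,
    as [x >= 1]. *)
Lemma le_prod_nb_points (x : R) (K n : nat) w : 1 <= x ->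
  nb_points X B w = n%:R%:E ->
  \prod_(j < K) (if w \in X j @^-1` (EFin @` B) then x else 1) <= x ^+ n.
Proof.
move=> x1 Nn.
rewrite -(big_mkord xpredT (fun j => if w \in X j @^-1` (EFin @` B) then x else 1)).
have -> : \prod_(0 <= j < K) (if w \in X j @^-1` (EFin @` B) then x else 1) =
    x ^+ (\sum_(0 <= j < K) (w \in X j @^-1` (EFin @` B)))%N.
  rewrite expr_sum; apply: eq_bigr => j _; by case: ifP; rewrite ?expr1 ?expr0.
apply: ler_weXn2l => //.
suff : ((\sum_(0 <= j < K) (w \in X j @^-1` (EFin @` B)))%N%:R%:E <= n%:R%:E :> \bar R)%E.
  by rewrite lee_fin ler_nat.
rewrite -Nn /nb_points counting_dirac natr_sum -sumEFin.
apply: le_trans (nneseries_lim_ge K _) => //=.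
Qed.

Lemma integral_prod_poisson (x : R) (K : nat) : 1 <= x ->
  (\int[P]_w (\prod_(j < K)
     (if w \in X j @^-1` (EFin @` B) then x else 1))%:E <=
   (expR (a * (x - 1)))%:E)%E.
Proof.
move=> x1; have x0 : 0 <= x by exact: le_trans x1.
pose f w := \prod_(j < K) (if w \in X j @^-1` (EFin @` B) then x else 1).
have f0 w : 0 <= f w by apply: prodr_ge0 => j _; case: ifP.
have mf : measurable_fun setT f.
  apply: measurable_prod => j _; apply: measurable_fun_if_mem => //.
  exact: measurable_point_in.
have mfE D : measurable_fun D (EFin \o f).
  by apply: measurable_funTS; exact/measurable_EFinP.
pose E n := [set w | nb_points X B w = n%:R%:E].
have mE n : measurable (E n).
  rewrite /E -[X in measurable X]setTI.
  have := measurable_nb_points measurableT (emeasurable_set1 (n%:R%:E : \bar R)).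
  by [].
have tE : trivIset setT E.
  move=> i j _ _ [w [Ei Ej]]; have : i%:R%:E = j%:R%:E :> \bar R.
    by rewrite -[LHS](Ei : nb_points X B w = _).
  by move=> [] /eqP; rewrite eqr_nat => /eqP.
pose D := \bigcup_n E n.
have mD : measurable D by exact: bigcupT_measurable.
(* The Poisson masses at the integers sum to 1, so an infinite count has probability 0 and the
   integral may be cut along the values of the count. *)
have PD : P D = 1%E.
  have := measure_semi_bigcup P mE tE mD; rewrite -/D => ->.
  have := poisson_series 1; rewrite mul1r -expRD addNr expR0 => <-.
  by apply: eq_eseriesr => n _; rewrite expr1n mul1r; exact: X_poisson.
have PDC : P (~` D) = 0%E by rewrite probability_setC// PD subee.
rewrite (ge0_negligible_integral (measurableC mD) measurableT (mfE _) _ PDC);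
  last first.
  by move=> w _; rewrite lee_fin f0.
rewrite setTD setCK ge0_integral_bigcup//; last by move=> w _; rewrite lee_fin f0.
apply: (@le_trans _ _ (\sum_(n <oo) (x ^+ n * (expR (- a) * a ^+ n / n`!%:R))%:E)%E).
  apply: lee_nneseries => [n _ _|n _] /=.
    by apply: integral_ge0 => w _; rewrite lee_fin f0.
  rewrite EFinM -X_poisson -/(E n) -integral_cst//; apply: ge0_le_integral => //.
  - by move=> w _; rewrite lee_fin f0.
  - by move=> w Ew; rewrite lee_fin; exact: le_prod_nb_points.
by rewrite poisson_series -expRD lee_fin ler_expR mulrBr mulr1 addrC mulrC.
Qed.

End PoissonCount.

(** * Replacing independent marks by bounds on their means *)

Section Peeling.
Context {d : measure_display} {T : measurableType d} {R : realType}.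
Variable P : probability T R.
Context {I : choiceType}.
Variable F : I -> set (set T).
Hypothesis F_sigma : forall i, sigma_algebra setT (F i).
Hypothesis F_meas : forall i, F i `<=` measurable.
Hypothesis F_indep : mutually_independent P F.

Local Notation sigma J := (g_sigma_algebraType (joint F J)).

Lemma joint_measurable J : <<s joint F J >> `<=` measurable.
Proof.
apply: smallest_sub; first exact: sigma_algebra_measurable.
by move=> A [i _]; exact: F_meas.
Qed.

Lemma joint_sub (J K : set I) : J `<=` K -> joint F J `<=` <<s joint F K >>.
Proof.
by move=> JK A [i Ji FA]; apply: sub_sigma_algebra; exists i => //; exact: JK.
Qed.

Lemma integral_independent_mul (J K : set I) (Y Z : T -> R) :
  J `&` K = set0 ->
  measurable_fun (setT : set (sigma J)) Y ->
  measurable_fun (setT : set (sigma K)) Z ->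
  (forall w, 0 <= Y w) -> (forall w, 0 <= Z w) ->
  (\int[P]_w (Y w * Z w)%:E = \int[P]_w (Y w)%:E * \int[P]_w (Z w)%:E)%E.
Proof.
move=> JK mY mZ Y0 Z0.
rewrite -(@expectation_independent_mul _ _ _ P (joint F J) (joint F K)).
- by apply: eq_integral => w _; rewrite EFinM.
- exact: joint_measurable.
- exact: joint_measurable.
- by move=> A B; exact: independent_joint.
- exact/measurable_EFinP.
- exact/measurable_EFinP.
- by move=> w; rewrite lee_fin.
- by move=> w; rewrite lee_fin.
Qed.

Lemma measurable_from_joint (J : set I) (Y : T -> R) :
  measurable_fun (setT : set (sigma J)) Y -> measurable_fun setT Y.
Proof.
apply: measurable_fun_from_sigma => A JA; apply: joint_measurable.
exact: sub_sigma_algebra JA.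
Qed.

Lemma measurable_fun_joint_sub (J K : set I) (Y : T -> R) : J `<=` K ->
  measurable_fun (setT : set (sigma J)) Y -> measurable_fun (setT : set (sigma K)) Y.
Proof. by move=> JK; apply: measurable_fun_sub_sigma; exact: joint_sub. Qed.

(** Split [Y] into its parts on and off [A]: only the first meets [Phi], and there independence
    factors the integral. *)
Lemma integral_peel1 (J K : set I) (Y Phi : T -> R) (A : set T) (x : R) :
  J `&` K = set0 -> <<s joint F J >> A ->
  measurable_fun (setT : set (sigma J)) Y ->
  measurable_fun (setT : set (sigma K)) Phi ->
  (forall w, 0 <= Y w) -> (forall w, 0 <= Phi w) -> 0 <= x ->
  (\int[P]_w (Phi w)%:E <= x%:E)%E ->
  (\int[P]_w (Y w * (if w \in A then Phi w else 1))%:E <=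
   \int[P]_w (Y w * (if w \in A then x else 1))%:E)%E.
Proof.
move=> JK sA mY mPhi Y0 Phi0 x0 Phix.
have mA : (measurable : set (set (sigma J))) A by [].
pose Y1 w := if w \in A then Y w else 0.
pose Y2 w := if w \in A then 0 else Y w.
have mY1 : measurable_fun (setT : set (sigma J)) Y1.
  exact: (measurable_fun_if_mem (S := sigma J) mA).
have mY2 : measurable_fun (setT : set (sigma J)) Y2.
  exact: (measurable_fun_if_mem (S := sigma J) mA).
have Y10 w : 0 <= Y1 w by rewrite /Y1; case: ifP.
have Y20 w : 0 <= Y2 w by rewrite /Y2; case: ifP.
have mY1' := measurable_from_joint mY1.
have mY2' := measurable_from_joint mY2.
have mPhi' := measurable_from_joint mPhi.
have E (Psi : T -> R) : (forall w, 0 <= Psi w) -> measurable_fun setT Psi ->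
  (\int[P]_w (Y w * (if w \in A then Psi w else 1))%:E =
   \int[P]_w (Y1 w * Psi w)%:E + \int[P]_w (Y2 w)%:E)%E.
  move=> Psi0 mPsi; rewrite -ge0_integralD//; first last.
  - exact/measurable_EFinP.
  - by move=> w _; rewrite lee_fin.
  - by apply/measurable_EFinP; exact: measurable_funM.
  - by move=> w _; rewrite lee_fin mulr_ge0.
  apply: eq_integral => w _; rewrite -EFinD /Y1 /Y2; congr EFin.
  by case: ifP => _; rewrite ?mul0r ?addr0 ?mulr1 ?add0r.
rewrite (E Phi)// (E (cst x))//; apply: leeD => //.
rewrite (integral_independent_mul JK)//=.
under [leRHS]eq_integral do rewrite EFinM.
rewrite ge0_integralZr//; last by move=> w _; rewrite lee_fin.
  by apply: lee_wpmul2l => //; apply: integral_ge0 => w _; rewrite lee_fin.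
exact/measurable_EFinP.
Qed.

Lemma integral_peel (n : nat) (J : set I) (K : nat -> set I) (Y : T -> R)
    (A : nat -> set T) (Phi : nat -> T -> R) (x : R) :
  (forall j, J `&` K j = set0) -> trivIset setT K ->
  (forall j, <<s joint F J >> (A j)) ->
  measurable_fun (setT : set (sigma J)) Y ->
  (forall j, measurable_fun (setT : set (sigma (K j))) (Phi j)) ->
  (forall w, 0 <= Y w) -> (forall j w, 0 <= Phi j w) -> 0 <= x ->
  (forall j, \int[P]_w (Phi j w)%:E <= x%:E)%E ->
  (\int[P]_w (Y w * \prod_(j < n) (if w \in A j then Phi j w else 1))%:E <=
   \int[P]_w (Y w * \prod_(j < n) (if w \in A j then x else 1))%:E)%E.
Proof.
move=> JK tK sA mY mPhi Y0 Phi0 x0 Phix.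
elim: n => [|n IH] in Y mY Y0 *.
  by under eq_integral do rewrite big_ord0;
    under [leRHS]eq_integral do rewrite big_ord0.
under eq_integral do rewrite big_ord_recr/= mulrA.
under [leRHS]eq_integral do rewrite big_ord_recr/= (mulrC _ (if _ then _ else _)) mulrA.
(* The last mark is removed first, with the earlier marks counted as part of the past: [Jn] collects
   all their sources. The constant left in its place is measurable for [J] and is absorbed into [Y]
   for the induction. *)
pose Jn := J `|` \bigcup_(j in `I_n) K j.
have JJn : J `<=` Jn by move=> i; left.
apply: (@le_trans _ _ (\int[P]_w (Y w * \prod_(j < n) (if w \in A j then Phi j w else 1) *
    (if w \in A n then x else 1))%:E)%E).
  apply: (@integral_peel1 Jn (K n)) => //.
  - rewrite setIUl JK set0U setI_bigcupl; apply: bigcup0 => j /= jn.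
    by move/trivIsetP : tK; apply => //; rewrite (ltn_eqF jn).
  - by apply: smallest_sub (sA n); [exact: smallest_sigma_algebra|exact: joint_sub].
  - apply: measurable_funM; first exact: measurable_fun_joint_sub mY.
    apply: measurable_prod => j _; apply: measurable_fun_if_mem => //.
      by apply: smallest_sub (sA j); [exact: smallest_sigma_algebra|exact: joint_sub].
    apply: measurable_fun_joint_sub (mPhi j) => i Kji; right; exists j => //=.
  - by move=> w; rewrite mulr_ge0// prodr_ge0// => j _; case: ifP.
have mA : (measurable : set (set (sigma J))) (A n) by exact: sA.
have mif : measurable_fun (setT : set (sigma J)) (fun w => if w \in A n then x else 1).
  exact: measurable_fun_if_mem.
have if0 w : 0 <= if w \in A n then x else 1 by case: ifP.
under [leLHS]eq_integral do rewrite mulrAC.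
apply: (IH (fun w => Y w * (if w \in A n then x else 1))).
- exact: measurable_funM.
- by move=> w; rewrite mulr_ge0.
Qed.

(* Independence replaces each mark Phi j by x; what remains is the generating
   function of the number of points in B. *)
Lemma branching_step (n : nat) (i0 i1 : I) (K : nat -> set I) (xi : T -> R)
    (X : nat -> T -> \bar R) (B : set R) (Phi : nat -> T -> R) (a x : R) :
  i0 != i1 -> (forall j, ~ K j i0) -> (forall j, ~ K j i1) -> trivIset setT K ->
  measurable_fun (setT : set (sigma [set i0])) xi -> (forall w, 0 <= xi w) ->
  (forall j, measurable_fun (setT : set (sigma [set i1])) (X j)) ->
  measurable B -> 0 <= a ->
  (forall k : nat, P [set w | nb_points X B w = k%:R%:E] =
     (expR (- a) * a ^+ k / k`!%:R)%:E) ->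
  (forall j, measurable_fun (setT : set (sigma (K j))) (Phi j)) ->
  (forall j w, 0 <= Phi j w) -> 1 <= x ->
  (forall j, \int[P]_w (Phi j w)%:E <= x%:E)%E ->
  (\int[P]_w (xi w * \prod_(j < n)
      (if w \in X j @^-1` (EFin @` B) then Phi j w else 1))%:E <=
   \int[P]_w (xi w)%:E * (expR (a * (x - 1)))%:E)%E.
Proof.
move=> i01 Ki0 Ki1 tK mxi xi0 mX mB a0 Xa mPhi Phi0 x1 Phix.
have x0 : 0 <= x by exact: le_trans x1.
have sXB j : <<s joint F [set i1] >> (X j @^-1` (EFin @` B)).
  by rewrite -[X in <<s _ >> X]setTI; apply: (mX j) => //; exact: measurable_image_EFin.
pose J := [set i0; i1].
have sub0 : [set i0] `<=` J by move=> i; left.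
have sub1 : [set i1] `<=` J by move=> i; right.
apply: (@le_trans _ _ (\int[P]_w (xi w * \prod_(j < n)
      (if w \in X j @^-1` (EFin @` B) then x else 1))%:E)%E).
  apply: (@integral_peel n J K xi (fun j => X j @^-1` (EFin @` B))) => //.
  - by move=> j; rewrite -subset0 => i [[]/= ->]; [exact: Ki0|exact: Ki1].
  - by move=> j; apply: smallest_sub (sXB j);
    [exact: smallest_sigma_algebra|exact: joint_sub].
  - exact: measurable_fun_joint_sub mxi.
have mXT j : measurable_fun setT (X j).
  apply: measurable_fun_from_sigma (mX j) => A JA; apply: joint_measurable.
  exact: sub_sigma_algebra JA.
rewrite (@integral_independent_mul [set i0] [set i1])//.
- apply: lee_wpmul2l; first by apply: integral_ge0 => w _; rewrite lee_fin.
  exact: integral_prod_poisson.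
- by rewrite -subset0 => i [/= -> /eqP]; rewrite (negbTE i01).
- by apply: measurable_prod => j _; apply: measurable_fun_if_mem => //; exact: sXB.
- by move=> w; apply: prodr_ge0 => j _; case: ifP.
Qed.

End Peeling.

HB.instance Definition _ := gen_eqMixin source.
HB.instance Definition _ := gen_choiceMixin source.

Section SigmaOf.
Context {d : measure_display} {T : measurableType d} {R : realType}.

Lemma sigma_of_measurable {dS : measure_display} {S : measurableType dS}
    {I : Type} (Y : I -> T -> S) : (forall i, measurable_fun setT (Y i)) ->
  sigma_of Y `<=` measurable.
Proof.
move=> mY; apply: smallest_sub; first exact: sigma_algebra_measurable.
by move=> _ [i _ [B mB <-]]; exact: mY.
Qed.

Lemma sigma_of_algebra {dS : measure_display} {S : measurableType dS}
    {I : Type} (Y : I -> T -> S) : sigma_algebra setT (sigma_of Y).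
Proof. exact: smallest_sigma_algebra. Qed.

Lemma measurable_sigma_of {J : choiceType} (F : J -> set (set T)) (j : J)
    {dS : measure_display} {S : measurableType dS} {I : Type} (Y : I -> T -> S)
    (i : I) : F j = sigma_of Y ->
  measurable_fun (setT : set (g_sigma_algebraType (joint F [set j]))) (Y i).
Proof.
move=> FY _ B mB; apply: sub_sigma_algebra; exists j => //; rewrite FY.
by apply: sub_sigma_algebra; exists i => //; exists B.
Qed.

End SigmaOf.

Section Positivity.
Context {d : measure_display} {T : measurableType d} {R : realType}.
Variable P : probability T R.

(** The intensity of the negative half-line is 0, so almost surely no point lies there. The value
    [-oo] cannot be excluded: like [+oo] it encodes a missing point, and [nb_points] counts real
    values only. *)
Lemma poisson_process_ge0 (X : nat -> T -> \bar R) (r : R -> R) :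
  poisson_process P X (r \_ `[0, +oo[) ->
  {ae P, forall w j, (X j w < 0)%E -> X j w = -oo%E}.
Proof.
move=> [mX X_poisson _].
pose B : set R := `]-oo, 0[%classic.
have mB : measurable B by exact: measurable_itv.
have r0 : (\int[lebesgue_measure]_(x in B) ((r \_ `[0, +oo[) x)%:E = 0)%E.
  apply: integral0_eq => x; rewrite /B /= in_itv/= => x0.
  by rewrite patchE memNset//= in_itv/= andbT leNgt x0.
have := X_poisson B mB; rewrite r0 => /(_ (ltry _) 0%N).
rewrite /= oppr0 expR0 expr0 mulr1 fact0 divr1 => P1.
have mE : measurable [set w | nb_points X B w = 0%R%:E].
  rewrite -[X in measurable X]setTI.
  by have := measurable_nb_points mX mB measurableT (emeasurable_set1 (0%:E : \bar R)).
exists (~` [set w | nb_points X B w = 0%R%:E]); split.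
- exact: measurableC.
- by rewrite probability_setC// P1 subee.
apply: subsetC => w /= Nw j; rewrite -[X in (X < _)%E -> _]/(X j w).
move: Nw; rewrite /nb_points counting_dirac.
case E : (X j w) => [x| |]//= Nw; rewrite lte_fin => x0.
pose D := [set k : nat | (EFin @` B) (X k w)].
have : (\sum_(0 <= n < j.+1) (\d_n D : \bar R) <= \sum_(n <oo) \d_n D)%E.
  exact: nneseries_lim_ge.
rewrite Nw big_mkord big_ord_recr/= {2}/dirac indicE mem_set; last first.
  by rewrite /D /= E; exists x => //; rewrite /B /= in_itv.
move=> h; suff : (1%:E <= 0%:E :> \bar R)%E by rewrite lee_fin ler10.
by apply: le_trans h; apply: leeDr; apply: sume_ge0.
Qed.

End Positivity.

(** * Exponential moments of the shared work *)

Definition points_in {T : Type} {R : realType} (X : nat -> T -> \bar R)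
  (B : set R) (j : nat) : set T := X j @^-1` (EFin @` B).

Section TruncatedWork.
Context {d : measure_display} {T : measurableType d} {R : realType}.
Variable P : probability T R.
Variable C : clusters P.

(* The work of u and its descendants over n generations, counting only the
   offspring with a label below K. *)
Fixpoint trunc_work (K n l : nat) (u : seq nat) (w : T) : R :=
  jobsize C l u w + (if n is n'.+1 then
    \sum_(j < K) (if w \in points_in (offspring C l u) setT j
                  then trunc_work K n' l ((j : nat) :: u) w else 0) else 0).

(** One parameter [K] truncates the clusters, the labels of the children and the generations, so
    that a single monotone limit suffices. Only the immigrant is required to arrive before [t]; its
    descendants are counted whatever their arrival times. *)
Definition top_work (t : R) (K : nat) (w : T) : R :=
  \sum_(l < K) (if w \in points_in (immigrant C) `[0, t[ l
                then trunc_work K K l [::] w else 0).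

(** The sources that determine the work of [u] and its descendants. A child is added at the head of
    a word, so the descendants of [u] are the words with suffix [u]. *)
Definition subtree (l : nat) (u : seq nat) : set source :=
  [set s | exists v, s = Offspring l (v ++ u) \/ s = JobSize l (v ++ u)].

Lemma subtree_cons l j u : subtree l (j :: u) `<=` subtree l u.
Proof. by move=> s [v E]; exists (rcons v j); rewrite cat_rcons. Qed.

Lemma cat_cons_inj (v v' u : seq nat) (i j : nat) : v ++ i :: u = v' ++ j :: u -> i = j.
Proof.
move=> /(congr1 rev) /eqP; rewrite !rev_cat !rev_cons !cat_rcons eqseq_cat//.
by move=> /andP[_ /eqP[]].
Qed.

Lemma trivIset_subtree l u : trivIset setT (fun j => subtree l (j :: u)).
Proof.
move=> i j _ _ [s [[v [->|->]] [v' [[]|[]]]]]//; exact: cat_cons_inj.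
Qed.

Lemma subtree_consP l u j : subtree l (j :: u) (Offspring l u) \/
  subtree l (j :: u) (JobSize l u) -> False.
Proof.
have h x : u = x ++ j :: u -> False.
  move=> /(congr1 size); rewrite size_cat/= => /eqP.
  by rewrite addnS -addSn -[X in X == _]add0n eqn_add2r.
by case=> -[x [] []] // /h.
Qed.

Variable S : 'I_2 -> T -> state R.
Variables (lambda0 m : R) (f : R -> R).
Context {d0 : measure_display} {O : measurableType d0}.
Variable Q : probability O R.
Variables b V : {RV Q >-> R}.
Hypothesis coupled : semi_synchronously_coupled lambda0 m f V C S.
Hypothesis m_gt0 : 0 < m.
Hypothesis lambda0_gt0 : 0 < lambda0.
Hypothesis b_ge0 : {ae Q, forall x, 0 <= b x}.
Hypothesis b_density : has_density b f.

Let F := source_sigma C S.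
Local Notation sigma J := (g_sigma_algebraType (joint F J)).

Let mimm := let: And3 h _ _ := ssc_immigrant coupled in h.
Let moff l u := let: And3 h _ _ := ssc_offspring coupled l u in h.

Lemma source_sigma_algebra i : sigma_algebra setT (F i).
Proof. by case: i => *; exact: sigma_of_algebra. Qed.

Lemma source_sigma_measurable i : F i `<=` measurable.
Proof.
case: i => [||l u|l u]; apply: sigma_of_measurable => i.
- exact: (ssc_measurable coupled).
- exact: mimm.
- exact: moff.
- by [].
Qed.

Lemma measurable_jobsize l u :
  measurable_fun (setT : set (sigma [set JobSize l u])) (jobsize C l u).
Proof. by have := measurable_sigma_of (F := F) (j := JobSize l u) tt (erefl _). Qed.

Lemma measurable_offspring l u j :
  measurable_fun (setT : set (sigma [set Offspring l u])) (offspring C l u j).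
Proof. exact: (measurable_sigma_of (F := F) (j := Offspring l u)). Qed.

Lemma measurable_immigrant j :
  measurable_fun (setT : set (sigma [set Immigrants])) (immigrant C j).
Proof. exact: (measurable_sigma_of (F := F) (j := Immigrants)). Qed.

Lemma measurable_trunc_work K n l u :
  measurable_fun (setT : set (sigma (subtree l u))) (trunc_work K n l u).
Proof.
elim: n u => [|n IH] u /=; apply: measurable_funD => //.
- apply: measurable_fun_joint_sub (@measurable_jobsize l u) => _ ->.
  by exists [::]; right.
- apply: measurable_fun_joint_sub (@measurable_jobsize l u) => _ ->.
  by exists [::]; right.
apply: measurable_sum => j; apply: measurable_fun_if_mem => //.
  have mo : measurable_fun (setT : set (sigma (subtree l u))) (offspring C l u j).
    apply: measurable_fun_sub_sigma (@measurable_offspring l u j).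
    by apply: joint_sub => _ ->; exists [::]; left.
  by rewrite -[X in measurable X]setTI; apply: mo => //;
    exact: (measurable_image_EFin measurableT).
apply: measurable_fun_joint_sub (IH _); exact: subtree_cons.
Qed.

Lemma expR_sum_if (J : Type) (s : seq J) (p : J -> bool) (g : J -> R) (c : R) :
  expR (c * \sum_(j <- s) (if p j then g j else 0)) =
  \prod_(j <- s) (if p j then expR (c * g j) else 1).
Proof.
rewrite mulr_sumr expR_sum; apply: eq_bigr => j _.
by case: ifP; rewrite ?mulr0 ?expR0.
Qed.

(** As [b] is almost surely nonnegative, its density [f] has mass 1 on the half-line to which the
    intensity is restricted. *)
Lemma offspring_mass :
  (\int[lebesgue_measure]_(x in setT) (((fun x => m * f x)%R \_ `[0, +oo[) x)%:E = m%:E)%E.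
Proof.
have [mf f0 bf] := b_density.
have -> : (\int[lebesgue_measure]_(x in setT) (((fun x => m * f x)%R \_ `[0, +oo[) x)%:E =
   \int[lebesgue_measure]_(x in `[0%R, +oo[) (m%:E * (f x)%:E))%E.
  rewrite [RHS]integral_mkcond; apply: eq_integral => x _.
  by rewrite !patchE; case: ifP.
rewrite ge0_integralZl//.
- rewrite -bf//= /distribution /pushforward (_ : Q _ = 1%E) ?mule1//.
  have [N [mN QN bN]] := b_ge0.
  apply/eqP; rewrite eq_le probability_le1/=;
    last by rewrite -[X in measurable X]setTI; exact: measurable_funP.
  have <- : Q (~` N) = 1%E by rewrite probability_setC// QN sube0.
  apply: le_measure; rewrite ?inE.
  - exact: measurableC.
  - by rewrite -[X in measurable X]setTI; exact: measurable_funP.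
  - by move=> x Nx /=; rewrite in_itv/= andbT; move/subsetCl : bN; exact.
- by apply/measurable_EFinP; exact: measurable_funTS.
- by move=> x _; rewrite lee_fin.
- by rewrite lee_fin ltW.
Qed.

Lemma offspring_poisson l u (k : nat) :
  P [set w | nb_points (offspring C l u) setT w = k%:R%:E] =
  (expR (- m) * m ^+ k / k`!%:R)%:E.
Proof.
have [_ h _] := ssc_offspring coupled l u.
by have := h setT measurableT; rewrite offspring_mass => /(_ (ltry _) k).
Qed.

Lemma immigrant_poisson t (k : nat) : 0 <= t ->
  P [set w | nb_points (immigrant C) `[0, t[ w = k%:R%:E] =
  (expR (- (lambda0 * t)) * (lambda0 * t) ^+ k / k`!%:R)%:E.
Proof.
move=> t0; have [_ h _] := ssc_immigrant coupled.
have := h `[0, t[%classic (measurable_itv _).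
have -> : (\int[lebesgue_measure]_(x in `[0%R, t[)
    ((cst lambda0 \_ `[0, +oo[) x)%:E = (lambda0 * t)%:E)%E.
  transitivity (\int[lebesgue_measure]_(x in `[0%R, t[) (cst lambda0%:E x))%E.
    apply: eq_integral => x; rewrite inE/= in_itv/= => /andP[x0 _].
    by rewrite patchE mem_set//= in_itv/= andbT.
  rewrite integral_cst//= lebesgue_measure_itv/= lte_fin.
  case: ltP => t0'; first by rewrite sube0.
  by rewrite mule0 (_ : t = 0) ?mulr0//; apply/le_anti/andP.
by move=> /(_ (ltry _) k).
Qed.

Variables (theta x : R).
Hypothesis x_ge1 : 1 <= x.
Hypothesis V_mgf : ('M_Q V theta * (expR (m * (x - 1)))%:E <= x%:E)%E.

Lemma integral_exp_jobsize l u :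
  (\int[P]_w (expR (theta * jobsize C l u w))%:E = 'M_Q V theta)%E.
Proof.
pose h := (fun y : R => (expR (theta * y))%:E).
have mh : measurable_fun setT h.
  by apply/measurable_EFinP; apply: measurableT_comp => //;
    exact: (measurable_funM (measurable_cst _) (@measurable_id _ _ _)).
have h0 y : (0 <= h y)%E by rewrite lee_fin expR_ge0.
rewrite -[LHS](ge0_integral_distribution (jobsize C l u) mh h0).
rewrite /mmt_gen_fun unlock.
transitivity (\int[distribution Q V]_y h y)%E.
  by apply: eq_measure_integral => A mA _; exact: (ssc_jobsize coupled).
rewrite (ge0_integral_distribution V mh h0); apply: eq_integral => w _ /=.
by rewrite /h mulrC.
Qed.

Lemma mgf_ge0 : (0 <= 'M_Q V theta)%E.
Proof.
by rewrite -(integral_exp_jobsize 0 [::]); apply: integral_ge0 => w _;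
  rewrite lee_fin expR_ge0.
Qed.

(** The number of children has generating function [exp(m (x - 1))]. If every child contributes at
    most [x], the parent contributes at most ['M_Q V theta * exp(m (x - 1)) <= x], so the bound
    passes from one generation to the next; a childless event satisfies it since [x >= 1]. *)
Lemma integral_exp_trunc_work K n l u :
  (\int[P]_w (expR (theta * trunc_work K n l u w))%:E <= x%:E)%E.
Proof.
elim: n u => [|n IH] u /=.
  under eq_integral do rewrite addr0.
  rewrite integral_exp_jobsize; apply: le_trans V_mgf.
  rewrite -[leLHS]mule1; apply: lee_wpmul2l; first exact: mgf_ge0.
  by rewrite lee_fin -[leLHS]expR0 ler_expR mulr_ge0 ?subr_ge0// ltW.
apply: le_trans V_mgf; rewrite -(integral_exp_jobsize l u).
under eq_integral do rewrite mulrDr expRD expR_sum_if.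
apply: (@branching_step _ _ _ P _ F source_sigma_algebra source_sigma_measurable
  (ssc_independent coupled) K (JobSize l u) (Offspring l u) (fun j => subtree l (j :: u))
  (fun w => expR (theta * jobsize C l u w)) (offspring C l u) setT
  (fun j w => expR (theta * trunc_work K n l (j :: u) w)) m x) => //.
- by apply/eqP.
- by move=> j h; apply: (@subtree_consP l u j); right.
- by move=> j h; apply: (@subtree_consP l u j); left.
- exact: trivIset_subtree.
- apply: measurableT_comp => //; apply: measurable_funM => //;
  exact: measurable_jobsize.
- by move=> j; exact: measurable_offspring.
- exact: ltW.
- exact: offspring_poisson.
- move=> j; apply: measurableT_comp => //; apply: measurable_funM => //;
  exact: measurable_trunc_work.
Qed.

(** The weight [xi] ranges over functions of the initial data: this makes the estimate a conditional
    one. *)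
Lemma integral_exp_top_work t K (xi : T -> R) : 0 <= t ->
  measurable_fun (setT : set (sigma [set Initial])) xi -> (forall w, 0 <= xi w) ->
  (\int[P]_w (xi w * expR (theta * top_work t K w))%:E <=
   \int[P]_w (xi w)%:E * (expR (lambda0 * t * (x - 1)))%:E)%E.
Proof.
move=> t0 mxi xi0.
under eq_integral do rewrite expR_sum_if.
apply: (@branching_step _ _ _ P _ F source_sigma_algebra source_sigma_measurable
  (ssc_independent coupled) K Initial Immigrants (fun l => subtree l [::])
  xi (immigrant C) `[0, t[%classic
  (fun l w => expR (theta * trunc_work K K l [::] w)) (lambda0 * t) x) => //.
- by apply/eqP.
- by move=> j [v []].
- by move=> j [v []].
- by move=> i j _ _ [s [[v [->|->]] [v' [[]|[]]]]].
- by move=> j; exact: measurable_immigrant.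
- by rewrite mulr_ge0// ltW.
- by move=> k; exact: immigrant_poisson.
- move=> j; apply: measurableT_comp => //; apply: measurable_funM => //;
  exact: measurable_trunc_work.
- by move=> l; exact: integral_exp_trunc_work.
Qed.

Lemma measurable_top_work t K : measurable_fun setT (top_work t K).
Proof.
apply: measurable_sum => l; apply: measurable_fun_if_mem => //.
  exact: (measurable_point_in mimm).
apply: measurable_from_joint (@measurable_trunc_work K K l [::]).
exact: source_sigma_measurable.
Qed.

End TruncatedWork.

Lemma ler_sum_subset {I : eqType} {R : numDomainType} (s s' : seq I) (g : I -> R) :
  uniq s -> {subset s <= s'} -> (forall i, 0 <= g i) ->
  \sum_(i <- s) g i <= \sum_(i <- s') g i.
Proof.
move=> us ss' g0; elim: s us s' ss' => [|x s IH] /= us s' ss'.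
  by rewrite big_nil sumr_ge0.
have xs' : x \in s' by apply: ss'; rewrite inE eqxx.
rewrite big_cons (big_rem _ xs')/= lerD2l; case/andP: us => xs us.
apply: IH => // y ys; have : y \in s' by apply: ss'; rewrite inE ys orbT.
rewrite (perm_mem (perm_to_rem xs')) inE => /orP[/eqP yx|//].
by move: xs; rewrite -yx ys.
Qed.

(** * Domination of the shared work by truncated cluster work *)

Section Domination.
Context {d : measure_display} {T : measurableType d} {R : realType}.
Variable P : probability T R.
Variable C : clusters P.

Definition regular_outcome (w : T) : Prop :=
  [/\ forall l u, 0 <= jobsize C l u w,
      forall l, (immigrant C l w < 0)%E -> immigrant C l w = -oo%E
    & forall l u j, (offspring C l u j w < 0)%E -> offspring C l u j w = -oo%E].

Variable w : T.
Hypothesis w_regular : regular_outcome w.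

Let V_ge0 l u : 0 <= jobsize C l u w. Proof. by case: w_regular. Qed.

Lemma arrival_lt0 l u : (arrival C l u w < 0)%E -> arrival C l u w = -oo%E.
Proof.
have [_ imm0 off0] := w_regular.
elim: u => [|j u IH] /=; first exact: imm0.
move: IH (off0 l u j).
case: (arrival C l u w) => [r| |]; case: (offspring C l u j w) => [s| |] //=.
rewrite -EFinD !lte_fin => hr hs rs0; case: (ltP r 0) => [/hr//|r0].
case: (ltP s 0) => [/hs//|s0].
by move: rs0; rewrite ltNge addr_ge0.
Qed.

Definition live (t : R) (l : nat) (u : seq nat) : bool :=
  (0%:E <= arrival C l u w < t%:E)%E.

(** If the sum of the parent's arrival time and the delay is real, both terms are real, hence
    nonnegative on a regular outcome; so every ancestor of an event that arrives before [t] also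
    arrives before [t]. *)
Lemma live_cons t l j u : live t l (j :: u) ->
  live t l u /\ w \in points_in (offspring C l u) setT j.
Proof.
rewrite /live /=; have [_ _ off0] := w_regular.
move: (@arrival_lt0 l u) (off0 l u j).
case: (arrival C l u w) => [r| |]; case E : (offspring C l u j w) => [s| |] //=;
  try by move=> _ _ /andP[].
rewrite -EFinD !lte_fin !lee_fin => hr hs /andP[rs0 rst].
split; last by rewrite inE /points_in /= E; exists s.
have r0 : 0 <= r by case: (ltP r 0) => // /hr.
have s0 : 0 <= s by case: (ltP s 0) => // /hs.
by rewrite r0 /= (le_lt_trans _ rst)// lerDl.
Qed.

Lemma trunc_work_ge0 K n l u : 0 <= trunc_work C K n l u w.
Proof.
elim: n u => [|n IH] u /=; first by rewrite addr0.
by rewrite addr_ge0// sumr_ge0// => j _; case: ifP.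
Qed.

Lemma ler_sum_ord (K K' : nat) (a c : nat -> R) : (K <= K')%N ->
  (forall j, a j <= c j) -> (forall j, 0 <= c j) ->
  \sum_(j < K) a j <= \sum_(j < K') c j.
Proof.
move=> KK' ac c0; rewrite -(big_mkord xpredT a) -(big_mkord xpredT c).
rewrite (big_cat_nat _ KK')//= -[leLHS]addr0; apply: lerD; first exact: ler_sum.
exact: sumr_ge0.
Qed.

Lemma trunc_work_le K K' n n' l u : (K <= K')%N -> (n <= n')%N ->
  trunc_work C K n l u w <= trunc_work C K' n' l u w.
Proof.
move=> KK'; elim: n n' u => [|n IH] [|n'] u //= nn'; rewrite lerD2l.
  by apply: sumr_ge0 => j _; case: ifP => // _; exact: trunc_work_ge0.
apply: (@ler_sum_ord K K' (fun j => if w \in points_in (offspring C l u) setT j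
    then trunc_work C K n l (j :: u) w else 0)
  (fun j => if w \in points_in (offspring C l u) setT j
    then trunc_work C K' n' l (j :: u) w else 0)) => // j; case: ifP => // _.
- exact: IH.
- exact: trunc_work_ge0.
Qed.

Lemma top_work_le t K K' : (K <= K')%N -> top_work C t K w <= top_work C t K' w.
Proof.
move=> KK'.
apply: (@ler_sum_ord K K' (fun l => if w \in points_in (immigrant C) `[0, t[ l
    then trunc_work C K K l [::] w else 0)
  (fun l => if w \in points_in (immigrant C) `[0, t[ l
    then trunc_work C K' K' l [::] w else 0)) => // j; case: ifP => // _.
- exact: trunc_work_le.
- exact: trunc_work_ge0.
Qed.

(** The words visited by [trunc_work K n l u], in its order of recursion. *)
Fixpoint words (K n : nat) (u : seq nat) : seq (seq nat) :=
  u :: (if n is n'.+1 then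
          flatten [seq words K n' (j :: u) | j <- iota 0 K] else [::]).

Lemma mem_words K n p u : (size p <= n)%N -> all (fun j => j < K)%N p ->
  p ++ u \in words K n u.
Proof.
elim: n u p => [|n IH] u p /=.
  by rewrite leqn0 size_eq0 => /eqP ->; rewrite inE eqxx.
case/lastP: p => [|p j]; first by rewrite inE eqxx.
rewrite size_rcons ltnS all_rcons => pn /andP[jK pK].
rewrite cat_rcons inE; apply/orP; right; apply/flattenP.
exists (words K n (j :: u)); last exact: IH.
by apply: map_f; rewrite mem_iota.
Qed.

Lemma sum_words t K n l u :
  \sum_(v <- words K n u) (if live t l v then jobsize C l v w else 0) <=
  if live t l u then trunc_work C K n l u w else 0.
Proof.
elim: n u => [|n IH] u.
  by rewrite /= big_seq1; case: ifP => //; rewrite addr0.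
rewrite [words _ _ _]/= big_cons big_flatten big_map.
have : \sum_(j <- iota 0 K) \sum_(v <- words K n (j :: u))
      (if live t l v then jobsize C l v w else 0) <=
    \sum_(j <- iota 0 K) (if live t l u && (w \in points_in (offspring C l u) setT j)
       then trunc_work C K n l (j :: u) w else 0).
  apply: ler_sum => j _; apply: le_trans (IH _) _.
  case: ifP => [/live_cons[-> ->]//|_].
  by case: ifP => // _; exact: trunc_work_ge0.
case: ifP => Lu h.
  rewrite /= lerD2l; apply: le_trans h _.
  by rewrite -[X in iota 0 X]subn0 -/(index_iota 0 K) big_mkord.
by rewrite add0r; apply: le_trans h _; rewrite big1.
Qed.

Lemma shared_work_le t (s : R) : (forall K, top_work C t K w <= s) ->
  (shared_work C t w <= s%:E)%E.
Proof.
move=> top_s; apply: ge_ereal_sup => _ [X [finX _] <-].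
rewrite fsbig_finite//=.
set E := finmap.enum_fset _.
have uE : uniq E by exact: finmap.fset_uniq.
pose g (lu : nat * seq nat) := if live t lu.1 lu.2 then jobsize C lu.1 lu.2 w else 0.
have g0 lu : 0 <= g lu by rewrite /g; case: ifP.
have -> : (\sum_(lu <- E)
    (if (0%:E <= arrival C lu.1 lu.2 w < t%:E)%E then (jobsize C lu.1 lu.2 w)%:E else 0%:E) =
   (\sum_(lu <- E) g lu)%:E)%E.
  by rewrite -sumEFin; apply: eq_bigr => lu _; rewrite /g /live; case: ifP.
rewrite lee_fin.
(* [N] exceeds at once the cluster label, the generation and every child label in the word, so its
   maximum over the finite set [E] is a truncation that contains [E]. *)
pose N (lu : nat * seq nat) := (lu.1 + size lu.2 + sumn lu.2).+1.
pose K := (\max_(lu <- E) N lu)%N.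
have NK lu : lu \in E -> (N lu <= K)%N.
  by move=> Xlu; rewrite /K (big_rem _ Xlu)/= leq_maxl.
apply: le_trans (top_s K).
pose s' := [seq (l, v) | l <- iota 0 K, v <- words K K [::]].
apply: (@le_trans _ _ (\sum_(lu <- s') g lu)).
  apply: ler_sum_subset => //.
  move=> lu /NK; case: lu => l u; rewrite /N/= => luK.
  apply/allpairsP; exists (l, u) => /=; split => //.
    by rewrite mem_iota /=; lia.
  rewrite -[u]cats0; apply: mem_words; first by lia.
  apply/allP => j uj; have : (j <= sumn u)%N.
    by rewrite sumnE (big_rem _ uj)/= leq_addr.
  by lia.
rewrite big_allpairs /top_work -(big_mkord xpredT (fun l =>
  if w \in points_in (immigrant C) `[0, t[ l then trunc_work C K K l [::] w else 0)).
rewrite /index_iota subn0; apply: ler_sum => l _;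
  apply: le_trans (sum_words t K K l [::]) _.
case: ifP => [|_]; last by case: ifP => // _; exact: trunc_work_ge0.
rewrite /live /= => /andP[]; case imm : (immigrant C l w) => [r| |]//.
rewrite lee_fin lte_fin => r0 rt; rewrite mem_set//.
by rewrite /points_in /= imm; exists r => //=; rewrite in_itv/= r0.
Qed.

End Domination.

(** * The exponential bound conditional on the initial data *)

Section ExponentialBound.
Context {d : measure_display} {T : measurableType d} {R : realType}.
Variable P : probability T R.
Variable C : clusters P.
Variable S : 'I_2 -> T -> state R.
Variables (lambda0 m : R) (f : R -> R).
Context {d0 : measure_display} {O : measurableType d0}.
Variable Q : probability O R.
Variables b V : {RV Q >-> R}.
Hypothesis coupled : semi_synchronously_coupled lambda0 m f V C S.
Hypothesis V_gt0 : {ae Q, forall x, 0 < V x}.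

Lemma ae_forall_countable {I : countType} (p : I -> T -> Prop) :
  (forall i, {ae P, forall w, p i w}) -> {ae P, forall w, forall i, p i w}.
Proof.
move=> hp.
have := @ae_foralln _ _ _ P (fun n w => if unpickle n is Some i then p i w else True).
have h n : {ae P, forall w, if @unpickle I n is Some i then p i w else True}.
  by case: unpickle => [i|]; [exact: hp|exact: aeW].
move=> /(_ h); apply: filterS => w hw i.
by have := hw (pickle i); rewrite pickleK.
Qed.

Lemma jobsize_ge0 l u : {ae P, forall w, 0 <= jobsize C l u w}.
Proof.
have mB : measurable (`[0, +oo[%classic : set R) by exact: measurable_itv.
have : distribution P (jobsize C l u) `[0, +oo[%classic = 1%E.
  rewrite (ssc_jobsize coupled)//.
  have [N [mN QN VN]] := V_gt0.
  apply/eqP; rewrite eq_le probability_le1//= /distribution /pushforward.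
  have <- : Q (~` N) = 1%E by rewrite probability_setC// QN sube0.
  apply: le_measure; rewrite ?inE.
  - exact: measurableC.
  - by rewrite -[X in measurable X]setTI; exact: measurable_funP.
  - move=> x Nx /=; rewrite in_itv/= andbT; apply: ltW.
    by move/subsetCl : VN; exact.
move=> P1; have mE : measurable (jobsize C l u @^-1` `[0, +oo[%classic).
  by rewrite -[X in measurable X]setTI; exact: measurable_funP.
exists (~` (jobsize C l u @^-1` `[0, +oo[%classic)); split.
- exact: measurableC.
- by rewrite probability_setC// [X in (_ - X)%E]P1 subee.
- by apply: subsetC => w /=; rewrite in_itv/= andbT.
Qed.

Lemma ae_regular_outcome : {ae P, forall w, regular_outcome C w}.
Proof.
have hV : {ae P, forall w, forall lu : nat * seq nat, 0 <= jobsize C lu.1 lu.2 w}.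
  by apply: ae_forall_countable => lu; exact: jobsize_ge0.
have hI := poisson_process_ge0 (ssc_immigrant coupled).
have hO : {ae P, forall w, forall lu : nat * seq nat, forall j,
    (offspring C lu.1 lu.2 j w < 0)%E -> offspring C lu.1 lu.2 j w = -oo%E}.
  by apply: ae_forall_countable => lu;
    exact: poisson_process_ge0 (ssc_offspring coupled _ _).
apply: filterS3 hV hI hO => w h1 h2 h3; split => //.
- by move=> l u; exact: (h1 (l, u)).
- by move=> l u; exact: (h3 (l, u)).
Qed.

Hypothesis m_gt0 : 0 < m.
Hypothesis lambda0_gt0 : 0 < lambda0.
Hypothesis b_ge0 : {ae Q, forall x, 0 <= b x}.
Hypothesis b_density : has_density b f.
Variables (theta x : R).
Hypothesis theta_gt0 : 0 < theta.
Hypothesis x_ge1 : 1 <= x.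
Hypothesis V_mgf : ('M_Q V theta * (expR (m * (x - 1)))%:E <= x%:E)%E.

(** [Psi] is the increasing limit of the exponentials of the truncated works. It is measurable as a
    limit, so that it can stand for [exp(theta A(t))] without any measurability of [shared_work]. *)
Lemma exp_shared_work_bound t : 0 <= t -> exists Psi : T -> \bar R,
  [/\ measurable_fun setT Psi, forall w, (0 <= Psi w)%E,
   forall xi : T -> R,
     measurable_fun (setT : set (g_sigma_algebraType (F0 S))) xi ->
     (forall w, 0 <= xi w) ->
     (\int[P]_w ((xi w)%:E * Psi w) <=
      \int[P]_w (xi w)%:E * (expR (lambda0 * t * (x - 1)))%:E)%E &
   {ae P, forall w, [/\ regular_outcome C w, (shared_work C t w < +oo)%E &
      ((expR (theta * fine (shared_work C t w)))%:E <= Psi w)%E]}].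
Proof.
move=> t0; have [N [mN PN Nreg]] := ae_regular_outcome.
have reg w : ~ N w -> regular_outcome C w.
  by move=> Nw; apply: contrapT => /Nreg.
(* Setting [psi] to 0 on the null set [N] makes the sequence nondecreasing at every outcome. *)
pose psi n w := if w \in N then 0 else expR (theta * top_work C t n w).
have mpsi n : measurable_fun setT (psi n).
  apply: measurable_fun_if_mem => //; apply: measurableT_comp => //.
  by apply: measurable_funM => //; exact: measurable_top_work coupled _ _.
have psi0 n w : 0 <= psi n w by rewrite /psi; case: ifP.
have psi_nd w : nondecreasing_seq (fun n => (psi n w)%:E).
  move=> n k nk; rewrite lee_fin /psi; case: ifPn => // wN.
  rewrite ler_expR ler_pM2l//; apply: top_work_le => //; apply: reg.
  by move: wN; rewrite notin_setE.
pose Psi w := limn (fun n => (psi n w)%:E).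
have PsiE w : Psi w = ereal_sup (range (fun n => (psi n w)%:E)).
  by apply/cvg_lim => //; exact: ereal_nondecreasing_cvgn.
have psi_Psi n w : ((psi n w)%:E <= Psi w)%E.
  by rewrite PsiE; apply: ereal_sup_ubound; exists n.
have cvgPsi w : (psi n w)%:E @[n --> \oo] --> Psi w.
  by rewrite PsiE; exact: ereal_nondecreasing_cvgn.
have mPsi : measurable_fun setT Psi.
  apply: (emeasurable_fun_cvg (fun n w => (psi n w)%:E)) => [n|w _].
    exact/measurable_EFinP.
  exact: cvgPsi.
have Psi0 w : (0 <= Psi w)%E by apply: le_trans (psi_Psi 0%N w); rewrite lee_fin.
have bound (xi : T -> R) :
     measurable_fun (setT : set (g_sigma_algebraType (F0 S))) xi ->
     (forall w, 0 <= xi w) ->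
     (\int[P]_w ((xi w)%:E * Psi w) <=
      \int[P]_w (xi w)%:E * (expR (lambda0 * t * (x - 1)))%:E)%E.
  move=> mxi xi0.
  have mxi' : measurable_fun setT xi.
    apply: measurable_fun_from_sigma mxi.
    exact: (source_sigma_measurable coupled (i := Initial)).
  have -> : (\int[P]_w ((xi w)%:E * Psi w) =
      limn (fun n => \int[P]_w (xi w * psi n w)%:E))%E.
    rewrite -monotone_convergence//.
    - apply: eq_integral => w _; apply/esym/cvg_lim => //.
      under eq_fun do rewrite EFinM.
      by apply: cvgeZl.
    - by move=> n; apply/measurable_EFinP; exact: measurable_funM.
    - by move=> n w _; rewrite lee_fin mulr_ge0.
    - move=> w _ n k nk; rewrite lee_fin ler_wpM2l//.
      by have := psi_nd w _ _ nk; rewrite lee_fin.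
  apply: lime_le.
    apply: ereal_nondecreasing_is_cvgn => n k nk; apply: ge0_le_integral => //.
    - by move=> w _; rewrite lee_fin mulr_ge0.
    - by apply/measurable_EFinP; exact: measurable_funM.
    - by apply/measurable_EFinP; exact: measurable_funM.
    - move=> w _; rewrite lee_fin ler_wpM2l//.
      by have := psi_nd w _ _ nk; rewrite lee_fin.
  apply: nearW => n.
  apply: (@le_trans _ _ (\int[P]_w (xi w * expR (theta * top_work C t n w))%:E)%E).
    apply: ge0_le_integral => //.
    - by move=> w _; rewrite lee_fin mulr_ge0.
    - by apply/measurable_EFinP; exact: measurable_funM.
    - apply/measurable_EFinP; apply: measurable_funM => //.
      apply: measurableT_comp => //; apply: measurable_funM => //.
      exact: measurable_top_work coupled _ _.
    - by move=> w _; rewrite lee_fin ler_wpM2l// /psi; case: ifP.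
  apply: (integral_exp_top_work coupled m_gt0 lambda0_gt0 b_ge0 b_density x_ge1 V_mgf) => //.
  apply: measurable_fun_sub_sigma mxi => A FA; apply: sub_sigma_algebra.
  by exists Initial.
exists Psi; split => //.
(* The weight [xi = 1] shows that [Psi] is integrable, hence almost surely finite; the finiteness of
   the shared work follows from it. *)
have Psi_fin : {ae P, forall w, Psi w \is a fin_num}.
  have : P.-integrable setT Psi.
    apply/integrableP; split => //.
    under eq_integral do rewrite gee0_abs//.
    have := bound (cst 1) (measurable_cst _) (fun=> ler01).
    rewrite (_ : \int[P]_w ((cst 1 w)%:E * Psi w) = \int[P]_w Psi w)%E; last first.
      by apply: eq_integral => w _; rewrite /= mul1e.
    move=> /le_lt_trans; apply.
    rewrite (_ : \int[P]_w (cst 1 w)%:E = 1)%E ?mul1e ?ltry//.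
    rewrite [LHS](integral_cst P measurableT 1%:E) mul1e.
    exact: probability_setT.
  by move=> /(integrable_ae measurableT); apply: filterS => w; exact.
have aeN : {ae P, forall w, ~ N w}.
  by exists N; split => // w /= /contrapT.
apply: filterS2 Psi_fin aeN => w Pw Nw; have rw := reg w Nw.
have Psi_gt0 : 0 < fine (Psi w).
  apply: (@lt_le_trans _ _ (psi 0%N w)).
    by rewrite /psi memNset// expR_gt0.
  by rewrite -lee_fin fineK.
(* Taking logarithms bounds all truncated works by one real number, which therefore bounds their
   supremum [shared_work]. *)
have top_le K : top_work C t K w <= ln (fine (Psi w)) / theta.
  rewrite ler_pdivlMr// mulrC -[leLHS]expRK ler_ln ?posrE ?expR_gt0//.
  by rewrite -lee_fin fineK// (le_trans _ (psi_Psi K w))// /psi memNset.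
have A_le := shared_work_le rw top_le.
have A_lty : (shared_work C t w < +oo)%E by exact: le_lt_trans A_le (ltry _).
split => //.
rewrite -[leRHS]fineK// lee_fin -[leRHS]lnK ?posrE// ler_expR.
rewrite mulrC -ler_pdivlMr// -lee_fin fineK// ge0_fin_numE//.
by apply: esum_ge0 => lu _; case: ifP => // _; rewrite lee_fin; case: rw.
Qed.

End ExponentialBound.

(** * Reflected paths *)

Section Reflection.
Context {R : realType}.
Implicit Types (Y a M : R -> R) (s t u : R).

Definition reflect_at Y t : R :=
  Y t - Num.min 0 (inf [set Y s | s in `[0, t]]).

Lemma inf_image_le Y t s (c : R) : (forall r, 0 <= r <= t -> c <= Y r) ->
  0 <= s <= t -> inf [set Y r | r in `[0, t]] <= Y s.
Proof.
move=> cY st; apply: ge_inf; last by exists s => //=; rewrite in_itv.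
by exists c => _ [r /= + <-]; rewrite in_itv/= => /cY.
Qed.

Lemma le_inf_image Y t (c : R) : 0 <= t -> (forall r, 0 <= r <= t -> c <= Y r) ->
  c <= inf [set Y r | r in `[0, t]].
Proof.
move=> t0 cY; apply: lb_le_inf.
  by exists (Y 0); exists 0 => //=; rewrite in_itv/= lexx.
by move=> _ [r /= + <-]; rewrite in_itv/= => /cY.
Qed.

Lemma reflect_at_le Y1 Y2 t (D c : R) : 0 <= t ->
  (forall r, 0 <= r <= t -> c <= Y2 r) ->
  Y1 t - Y2 t <= D ->
  (forall s, 0 <= s <= t -> (Y1 t - Y1 s) - (Y2 t - Y2 s) <= D) ->
  reflect_at Y1 t <= reflect_at Y2 t + D.
Proof.
move=> t0 cY2 Dt Ds; rewrite /reflect_at.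
set i1 := inf _; set i2 := inf _.
have h1 : Y1 t - Y2 t + i2 - D <= i1.
  apply: le_inf_image => // r rt; have := Ds r rt.
  by have := inf_image_le cY2 rt; rewrite -/i2; lra.
have m0 : Num.min 0 i2 <= 0 by rewrite ge_min lexx.
have m2 : Num.min 0 i2 <= i2 by rewrite ge_min lexx orbT.
by rewrite {1}/Num.min; case: ifP => _; lra.
Qed.

Variables (mu t : R) (a : R -> R).
Hypothesis mu_gt0 : 0 < mu.
Hypothesis t_ge0 : 0 <= t.
Hypothesis a_ge0 : forall s, 0 <= s <= t -> 0 <= a s.
Hypothesis a_nd : forall s u, 0 <= s -> s <= u -> u <= t -> a s <= a u.

Let B s := a s - mu * s.

Let B_ge s : 0 <= s <= t -> - (mu * t) <= B s.
Proof.
move=> /[dup] /a_ge0 a0 /andP[s0 st]; rewrite /B.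
by have := ler_wpM2l (ltW mu_gt0) st; lra.
Qed.

(** [B] is left-continuous with upward jumps and drift [- mu]. The minimizer is the last time [s]
    around which the infimum [I] is approached: the supremum of the set [G] of times after which [B]
    still comes arbitrarily close to [I]. *)
Lemma argmin_exists :
  (forall s e, 0 < s <= t -> 0 < e -> exists2 r, 0 <= r < s & a s - e <= a r) ->
  exists2 s, 0 <= s <= t & forall r, 0 <= r <= t -> B s <= B r.
Proof.
move=> a_lc; pose I := inf [set B s | s in `[0, t]].
have I_le r : 0 <= r <= t -> I <= B r by exact: inf_image_le B_ge.
pose G := [set s | 0 <= s <= t /\
  forall e, 0 < e -> exists2 r, s <= r <= t & B r < I + e].
have infB : has_inf [set B s | s in `[0, t]].
  split; first by exists (B 0); exists 0 => //=; rewrite in_itv/= lexx.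
  by exists (- (mu * t)) => _ [r /= + <-]; rewrite in_itv/= => /B_ge.
have G0 : G 0.
  split; first by rewrite lexx.
  move=> e /inf_adherent /(_ infB) [_ [r /= + <-]]; rewrite in_itv/= => rt ?.
  by exists r.
have supG : has_sup G by split; [exists 0|exists t => s [/andP[]]].
pose s := sup G.
have s0 : 0 <= s by apply: ub_le_sup => //; case: supG.
have st : s <= t by apply: ge_sup => [|r [/andP[]]//]; exists 0.
exists s; first by rewrite s0.
suff BsI : B s <= I by move=> r /I_le; exact: le_trans.
apply/ler_addgt0Pr => e' e'0; pose e := e' / 3.
have e0 : 0 < e by rewrite divr_gt0.
have [g [Gg ag]] : exists g, G g /\ forall r, g <= r <= t -> a s - e <= a r.
  move: s0; rewrite le_eqVlt => /orP[/eqP s0|s0].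
    exists 0; split => // r /andP[r0 rt]; rewrite -s0.
    by have := a_nd (lexx 0) r0 rt; lra.
  have [r0 /andP[r00 r0s] ar0] := a_lc s e (introT andP (conj s0 st)) e0.
  have sr0 : 0 < s - r0 by lra.
  have [g Gg gr0] := sup_adherent sr0 supG.
  exists g; split => // r /andP[gr rt].
  have : r0 <= r by move: gr0; rewrite -/s; lra.
  by move=> r0r; have := a_nd r00 r0r rt; lra.
(* A near-minimizer [r] is sought in [[g, h)], with [g] in [G] and [h] beyond its supremum. There
   [a r >= a s - e] by left continuity and monotonicity, and the drift costs at most
   [mu * (r - s) <= e]; with the error [e] of [r] itself this gives [B s < I + 3 * e]. *)
pose h := s + e / mu.
have sh : s < h by rewrite ltrDl divr_gt0.
have [r [/andP[gr rt] rh Br]] : exists r, [/\ g <= r <= t, r < h & B r < I + e].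
  case: Gg => _ Gg.
  case: (ltP t h) => [th|ht].
    have [r /andP[gr rt] Br] := Gg e e0.
    by exists r; split => //; [rewrite gr|exact: le_lt_trans th].
  (* Since [h] is not in [G], on [[h, t]] the path stays at least some [e1 > 0] above [I]; a
     near-minimizer with a tolerance of at most [e1] must lie before [h]. *)
  have nGh : ~ G h.
    move=> Gh; have : h <= s by apply: ub_le_sup => //; case: supG.
    by rewrite leNgt sh.
  have [e1 e10 He1] : exists2 e1, 0 < e1 & forall r, h <= r <= t -> I + e1 <= B r.
    apply: contrapT => nh; apply: nGh; split;
      first by rewrite ht (le_trans s0 (ltW sh)).
    move=> e1 e10; apply: contrapT => nr; apply: nh; exists e1 => // r rt.
    by rewrite leNgt; apply/negP => Br; apply: nr; exists r.
  have [] := Gg (Num.min e e1); first by rewrite lt_min e0.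
  move=> r /andP[gr rt] Br; exists r; split; first by rewrite gr.
    rewrite ltNge; apply/negP => hr; have := He1 r; rewrite hr rt => /(_ isT).
    by apply/negP; rewrite -ltNge (lt_le_trans Br)// lerD2l ge_min lexx orbT.
  by rewrite (lt_le_trans Br)// lerD2l ge_min lexx.
have := ag r; rewrite gr rt => /(_ isT) asr.
have mrs : mu * (r - s) <= e.
  rewrite mulrC -ler_pdivlMr//; move: rh; rewrite /h; lra.
move: Br; rewrite /B /e; rewrite /e in asr mrs; lra.
Qed.

Section OneSystem.
Variables (W J L : R) (M : R -> R).
Hypothesis W_ge0 : 0 <= W.
Hypothesis L_ge0 : 0 <= L.
Hypothesis M_ge0 : forall s, 0 <= M s.
Hypothesis M_le : forall s, M s <= J.
Hypothesis M_late : forall s, L < s -> M s = J.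

Let Y s := W + (a s + M s - mu * s).

Let J_ge0 : 0 <= J. Proof. exact: le_trans (M_ge0 0) (M_le 0). Qed.

Let Y_ge s : 0 <= s <= t -> - (mu * t) <= Y s.
Proof.
move=> /B_ge; rewrite /B /Y; have := M_ge0 s; move: W_ge0.
lra.
Qed.

Lemma negative_late s : 0 <= s <= t -> W + J + mu * L + B s < 0 -> L < s.
Proof.
have := W_ge0; have := J_ge0; move=> J0 W0 /a_ge0 a0; rewrite /B => h.
by rewrite -(ltr_pM2l mu_gt0); lra.
Qed.

(** The hypothesis at the single time [s] persists for all later [u], because the infimum of [B]
    over [[0, u]] is at most [B s]. This is what lets whole paths on [[s, t]], and hence busy times,
    be compared. *)
Lemma reflect_at_shared s u : 0 <= s -> s <= u -> u <= t ->
  W + J + mu * L + B s < 0 ->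
  reflect_at Y u = B u - inf [set B r | r in `[0, u]].
Proof.
have W0 := W_ge0; have J0 := J_ge0.
move=> s0 su ut Es; have u0 : 0 <= u by exact: le_trans su.
have st : 0 <= s <= t by rewrite s0 (le_trans su).
have Ls := negative_late st Es.
have Bu r : 0 <= r <= u -> - (mu * t) <= B r.
  by move=> /andP[r0 ru]; apply: B_ge; rewrite r0 (le_trans ru).
have Yu r : 0 <= r <= u -> - (mu * t) <= Y r.
  by move=> /andP[r0 ru]; apply: Y_ge; rewrite r0 (le_trans ru).
set iB := inf _.
have iBs : iB <= B s by apply: inf_image_le Bu _; rewrite s0.
have iYE : inf [set Y r | r in `[0, u]] = W + J + iB.
  apply/eqP; rewrite eq_le; apply/andP; split.
    rewrite -lerBlDl; apply: le_inf_image => // r ru.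
    have := inf_image_le Yu ru; rewrite /Y /B; have := M_le r; lra.
  (* After [L] all the memory work is in, and [Y] is [W + J + B]. Up to [L], [Y] is at least
     [- mu * L], which by hypothesis is above [W + J + B s], hence above [W + J + iB]. *)
  apply: le_inf_image => // r ru.
  case: (ltP L r) => [Lr|rL].
    by have := inf_image_le Bu ru; rewrite -/iB /Y /B M_late//; lra.
  have ar0 : 0 <= a r by apply: a_ge0; case/andP: ru => -> ru; rewrite (le_trans ru).
  have muL : mu * r <= mu * L by rewrite ler_pM2l.
  rewrite /Y; have := M_ge0 r; lra.
have muL0 : 0 <= mu * L by rewrite mulr_ge0// ltW.
rewrite /reflect_at iYE min_r; last by lra.
by rewrite /Y (M_late (lt_le_trans Ls su)) /B; lra.
Qed.

End OneSystem.

Lemma sup_from (I : set R) (s : R) : I s -> (exists c, forall x, I x -> x <= c) ->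
  sup I = sup [set x | I x /\ s <= x].
Proof.
move=> Is [c Ic]; apply/eqP; rewrite eq_le; apply/andP; split.
  apply: ge_sup; first by exists s.
  move=> x Ix; case: (leP s x) => sx.
    by apply: ub_le_sup => //; exists c => y [/Ic].
  apply: le_trans (ltW sx) _; apply: ub_le_sup => //; exists c => y [/Ic //].
apply: ge_sup; first by exists s.
by move=> x [Ix _]; apply: ub_le_sup => //; exists c => y /Ic.
Qed.

End Reflection.

HB.instance Definition _ (R : realType) := gen_eqMixin (event R).
HB.instance Definition _ (R : realType) := gen_choiceMixin (event R).

Section Memory.
Context {R : realType}.
Variable s : state R.

Lemma mem_eventP (e : event R) : reflect
  (exists l k, [/\ (l < size (memory0 s))%N, (k < size (nth [::] (memory0 s) l))%N &
     e = ev (nth [::] (memory0 s) l) k]) (e \in flatten (memory0 s)).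
Proof.
apply: (iffP flattenP) => [[c /(nthP [::])[l ls <-] /(nthP (Event 0 0 0))[k kc <-]]|].
  by exists l, k.
by move=> [l [k [ls kc ->]]]; exists (nth [::] (memory0 s) l); exact: mem_nth.
Qed.

Lemma residual_lifetime_ge0 : 0 <= residual_lifetime s.
Proof.
by rewrite /residual_lifetime; elim/big_rec: _ => // e x _ x0;
  rewrite le_max x0 orbT.
Qed.

Lemma residual_lifetime_leP (y : R) :
  residual_lifetime s <= y <->
  0 <= y /\ forall e, e \in flatten (memory0 s) -> ev_time e <= y.
Proof.
rewrite /residual_lifetime; elim: (flatten _) => [|e es IH].
  by rewrite big_nil; split => [|[]].
rewrite big_cons ge_max; split.
  move=> /andP[ey /IH[y0 esy]]; split => // e'.
  by rewrite inE => /orP[/eqP ->|/esy].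
move=> [y0 h]; apply/andP; split; first by apply: h; rewrite inE eqxx.
by apply/IH; split => // e' e'es; apply: h; rewrite inE e'es orbT.
Qed.

Hypothesis s_valid : valid_state s.

Lemma event_job_ge0 e : e \in flatten (memory0 s) -> 0 <= ev_job e.
Proof.
have [_ _ h] := s_valid.
by move=> /mem_eventP[l [k [ls kc ->]]]; have [_ _ _ /(_ k kc)/ltW] := h l ls.
Qed.

Lemma memory_work_ge0 u : 0 <= memory_work s u.
Proof. by rewrite /memory_work big_seq_cond sumr_ge0// => e /andP[/event_job_ge0]. Qed.

Lemma memory_work_le u : memory_work s u <= residual_job_size s.
Proof.
rewrite /memory_work /residual_job_size [leLHS]big_mkcond [leRHS]big_mkcond.
rewrite [leLHS]big_seq [leRHS]big_seq; apply: ler_sum => e /event_job_ge0 e0.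
by case: (0 <= ev_time e); rewrite //=; case: ifP.
Qed.

Lemma memory_work_nd u v : u <= v -> memory_work s u <= memory_work s v.
Proof.
move=> uv; rewrite /memory_work [leLHS]big_mkcond [leRHS]big_mkcond.
rewrite [leLHS]big_seq [leRHS]big_seq; apply: ler_sum => e /event_job_ge0 e0.
case: ifP => [/andP[-> /lt_le_trans ->]//|_]; by case: ifP.
Qed.

(** The inequality must be strict: an event at the very time of the residual lifetime is counted
    only for windows [[0, u)] with a larger [u]. *)
Lemma memory_work_late u : residual_lifetime s < u ->
  memory_work s u = residual_job_size s.
Proof.
move=> Lu; rewrite /memory_work /residual_job_size.
rewrite [LHS]big_seq_cond [RHS]big_seq_cond; apply: eq_bigl => e.
case: (boolP (e \in _)) => //= es;
  have [_ /(_ _ es) eL] := (residual_lifetime_leP _).1 (lexx _).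
by rewrite (le_lt_trans eL Lu) andbT.
Qed.

End Memory.

(** * Comparison of the two systems on a fixed regular outcome *)

Section Path.
Context {d : measure_display} {T : measurableType d} {R : realType}.
Variable P : probability T R.
Variable C : clusters P.
Variable w : T.
Hypothesis w_regular : regular_outcome C w.

Let V_ge0 l u : 0 <= jobsize C l u w. Proof. by case: w_regular. Qed.

Lemma shared_work_ge0 t : (0 <= shared_work C t w)%E.
Proof. by apply: esum_ge0 => lu _; case: ifP => // _; rewrite lee_fin. Qed.

Lemma live_le s t l u : s <= t -> live C w s l u -> live C w t l u.
Proof. by move=> st /andP[a0 a_s]; rewrite /live a0 (lt_le_trans a_s)// lee_fin. Qed.

Lemma shared_work_nd s t : s <= t -> (shared_work C s w <= shared_work C t w)%E.
Proof.
move=> st; apply: le_esum => lu _.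
case: ifP => [/(live_le st)|_]; first by rewrite /live => ->.
by case: ifP => // _; rewrite lee_fin.
Qed.

(** The window [[0, t)] is open on the right, so finitely many events that arrive before [t] all
    arrive before some earlier time. Applied to a finite set that carries almost all the work, this
    gives the left continuity of the shared work. *)
Lemma live_left t (E : seq (nat * seq nat)) : 0 < t ->
  exists2 r, 0 <= r < t & forall lu, lu \in E -> live C w t lu.1 lu.2 -> live C w r lu.1 lu.2.
Proof.
move=> t0; elim: E => [|lu E [r /andP[r0 rt] IH]]; first by exists 0; rewrite ?lexx.
case: (boolP (live C w t lu.1 lu.2)) => [lt|nlt]; last first.
  exists r; rewrite ?r0// => lu'; rewrite inE => /orP[/eqP -> h|/IH//].
  by rewrite h in nlt.
have [y ay] : exists y, arrival C lu.1 lu.2 w = y%:E.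
  move: lt; rewrite /live; case: arrival => [y|/andP[_]|/andP[]]//; by exists y.
have /andP[y0 yt] : 0 <= y < t by move: lt; rewrite /live ay lee_fin lte_fin.
pose r' := Num.max r ((y + t) / 2).
exists r'; first by rewrite le_max r0/= gt_max rt; lra.
move=> lu'; rewrite inE => /orP[/eqP -> _|/IH h /h]; last first.
  by apply: live_le; rewrite le_max lexx.
rewrite /live ay lee_fin lte_fin y0/= lt_max; apply/orP; right; lra.
Qed.

Lemma shared_work_left t (e : R) : 0 < t -> (shared_work C t w < +oo)%E -> 0 < e ->
  exists2 r, 0 <= r < t & (shared_work C t w - e%:E <= shared_work C r w)%E.
Proof.
move=> t0 At e0.
have At_fin : shared_work C t w \is a fin_num by rewrite ge0_fin_numE// shared_work_ge0.
have [_ [X [finX _] <-] hX] := ub_ereal_sup_adherent e0 At_fin.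
have [r rt hr] := live_left (finmap.enum_fset (fset_set X)) t0.
exists r => //; apply: le_trans (ltW hX) _.
apply: esum_ge; exists X => //.
rewrite !fsbig_finite//= big_seq [leRHS]big_seq; apply: lee_sum => lu luX.
case: ifP => [/(hr _ luX)|_]; first by rewrite /live => ->.
by case: ifP => // _; rewrite lee_fin.
Qed.

Variables (mu t : R).
Hypothesis mu_gt0 : 0 < mu.
Hypothesis t_ge0 : 0 <= t.
Hypothesis A_fin : (shared_work C t w < +oo)%E.
Variable S : 'I_2 -> T -> state R.
Hypothesis S_valid : forall i, valid_state (S i w).

Let a s := fine (shared_work C s w).

Let a_fin s : s <= t -> shared_work C s w \is a fin_num.
Proof.
move=> st; rewrite ge0_fin_numE ?shared_work_ge0//.
by apply: le_lt_trans A_fin; exact: shared_work_nd.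
Qed.

Let a_ge0 s : 0 <= s <= t -> 0 <= a s.
Proof. by move=> _; apply: fine_ge0; exact: shared_work_ge0. Qed.

Let a_nd s u : 0 <= s -> s <= u -> u <= t -> a s <= a u.
Proof.
move=> _ su ut; apply: fine_le; [exact: a_fin (le_trans su ut)|exact: a_fin|].
exact: shared_work_nd.
Qed.

Let a_left s e : 0 < s <= t -> 0 < e -> exists2 r, 0 <= r < s & a s - e <= a r.
Proof.
move=> /andP[s0 st] e0.
have As : (shared_work C s w < +oo)%E by apply: le_lt_trans A_fin;
  exact: shared_work_nd.
have [r /andP[r0 rs] h] := shared_work_left s0 As e0.
exists r; first by rewrite r0.
rewrite -lee_fin EFinB /a !fineK//; apply: a_fin => //.
exact: le_trans (ltW rs) st.
Qed.

Let W i := workload0 (S i w).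
Let J i := residual_job_size (S i w).
Let L i := residual_lifetime (S i w).
Let M i := memory_work (S i w).
Let Y i s := W i + (a s + M i s - mu * s).
Let B s := a s - mu * s.

Let W_ge0 i : 0 <= W i. Proof. by case: (S_valid i). Qed.
Let M_ge0 i u : 0 <= M i u. Proof. exact: memory_work_ge0. Qed.
Let M_le i u : M i u <= J i. Proof. exact: memory_work_le. Qed.
Let M_late i u : L i < u -> M i u = J i. Proof. exact: memory_work_late. Qed.
Let L_ge0 i : 0 <= L i. Proof. exact: residual_lifetime_ge0. Qed.

Let workloadE i s : workload mu C (S i) s w = reflect_at (Y i) s.
Proof. by []. Qed.

(* Had the server idled until the residual lifetime, all the work received so
   far would still have been served by time t. *)
Definition drained i : Prop :=
  workload0 (S i w) + residual_job_size (S i w) + mu * residual_lifetime (S i w)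
  + (fine (shared_work C t w) - mu * t) < 0.

(** The shared work and the service cancel. Over [[s, t]] the increments differ by memory work only,
    hence by at most [J i]; the term for time 0 adds the difference of the initial workloads. *)
Lemma workload_gap i j :
  workload mu C (S i) t w - workload mu C (S j) t w <=
  `|workload0 (S i w) - workload0 (S j w)|
  + Num.max (residual_job_size (S i w)) (residual_job_size (S j w)).
Proof.
rewrite lerBlDl !workloadE -/(W i) -/(W j) -/(J i) -/(J j).
have Wij : W i - W j <= `|W i - W j| by exact: ler_norm.
have Ji : J i <= Num.max (J i) (J j) by rewrite le_max lexx.
have n0 : 0 <= `|W i - W j| by [].
apply: (@reflect_at_le _ _ _ _ _ (- (mu * t))) => //.
- move=> r rt; have := a_ge0 rt; have := W_ge0 j; have := M_ge0 j r.
  move: rt => /andP[r0 rt]; have := ler_wpM2l (ltW mu_gt0) rt; rewrite /Y; lra.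
- rewrite /Y; have := M_ge0 j t; have := M_le i t; lra.
- move=> s /andP[s0 st]; rewrite /Y; have := M_ge0 i s; have := M_le i t.
  by have := memory_work_nd (S_valid j) st; rewrite -/(M j s) -/(M j t); lra.
Qed.

Lemma workload_drained i : drained i ->
  workload mu C (S i) t w = B t - inf [set B r | r in `[0, t]].
Proof.
move=> h; rewrite workloadE.
exact: (reflect_at_shared mu_gt0 a_ge0 (W_ge0 i) (L_ge0 i) (M_ge0 i) (M_le i)
   (@M_late i) t_ge0 (lexx _) (lexx _) h).
Qed.

Lemma observed_busy_bounds i :
  0 <= observed_busy mu C (S i) t w <= busy0 (S i w) + t.
Proof.
have [_ X0 _] := S_valid i.
rewrite /observed_busy; case: asboolP => [[s [/= st Ws]]|_];
  last by rewrite addr_ge0 ?lexx.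
set I := [set s | _].
have It x : I x -> x <= t by move=> [/=]; rewrite in_itv/= => /andP[].
have I0 x : I x -> 0 <= x by move=> [/=]; rewrite in_itv/= => /andP[].
have Is : I s by [].
have s1 : sup I <= t by apply: ge_sup; [exists s|move=> x /It].
have s2 : s <= sup I by apply: ub_le_sup => //; exists t => x /It.
have := I0 s Is; lra.
Qed.

(** The time [s] is a minimizer of [B] on [[0, t]]; [B] involves only shared work, so [s] is the
    same for both systems. A drained system is empty at [s] and follows the common path afterwards,
    so its last idle time before [t] is read off that path. *)
Lemma observed_busy_drained : exists s, forall i, drained i ->
  observed_busy mu C (S i) t w =
  t - sup [set u | s <= u <= t /\ B u - inf [set B r | r in `[0, u]] = 0].
Proof.
have [s /andP[s0 st] sB] := argmin_exists mu_gt0 t_ge0 a_ge0 a_nd a_left.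
exists s => i Ei.
(* The negativity assumed at [t] carries over to [s], because [B s <= B t]. *)
have Es : W i + J i + mu * L i + (a s - mu * s) < 0.
  have := sB t; rewrite t_ge0 lexx => /(_ isT).
  by move: Ei; rewrite /drained -/(W i) -/(J i) -/(L i) -/(a t); lra.
have WB u : s <= u -> u <= t ->
    workload mu C (S i) u w = B u - inf [set B r | r in `[0, u]].
  move=> su ut; rewrite workloadE.
  exact: (reflect_at_shared mu_gt0 a_ge0 (W_ge0 i) (L_ge0 i) (M_ge0 i) (M_le i)
   (@M_late i) s0 su ut Es).
have Ws : workload mu C (S i) s w = 0.
  rewrite WB//; apply/eqP; rewrite subr_eq0 eq_le; apply/andP; split.
    apply: le_inf_image => // r /andP[r0 rs]; apply: sB.
    by rewrite r0 (le_trans rs st).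
  apply: (@inf_image_le _ B s s (B s)); last by rewrite s0 lexx.
  by move=> r /andP[r0 rs]; apply: sB; rewrite r0 (le_trans rs st).
rewrite /observed_busy; case: asboolP => [_|[]]; last first.
  by exists s; split => //=; rewrite in_itv/= s0.
congr (_ - _); rewrite (@sup_from _ _ s).
- congr sup; rewrite predeqE => u /=; split.
    by move=> [[]]; rewrite in_itv/= => /andP[u0 ut] Wu su; rewrite su ut -WB.
  move=> [/andP[su ut] h]; rewrite in_itv/= ut (le_trans s0 su); split => //.
  by rewrite WB.
- by split => //=; rewrite in_itv/= s0.
- by exists t => x [/=]; rewrite in_itv/= => /andP[].
Qed.

End Path.

(** * Conditional expectation bounds *)

Section ConditionalBound.
Context {d : measure_display} {T : measurableType d} {R : realType}.
Variable P : probability T R.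
Local Open Scope ereal_scope.

Import HBNNSimple.

(* No measurability of Y: the integral of a nonnegative function is a supremum
   over the simple functions below it. *)
Lemma le_integral_nonmeasurable (D : set T) (Y U : T -> \bar R) :
  measurable D -> measurable_fun setT U ->
  (forall w, 0 <= Y w) -> (forall w, 0 <= U w) ->
  {ae P, forall w, Y w <= U w} ->
  \int[P]_(w in D) Y w <= \int[P]_(w in D) U w.
Proof.
move=> mD mU Y0 U0 [N [mN PN YU]].
have nN w : ~ N w -> Y w <= U w by move=> Nw; apply: contrapT => /YU.
rewrite (ge0_negligible_integral mN mD (measurable_funS measurableT (@subsetT _ _) mU) _ PN)//.
rewrite [leRHS]integral_mkcond [leLHS]ge0_integralE//.
apply: ge_ereal_sup => _ [h /= hY <-].
rewrite -integralT_nnsfun.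
rewrite (ge0_negligible_integral mN measurableT _ _ PN)//; last 2 first.
- exact/measurable_EFinP.
- by move=> w _; rewrite lee_fin.
rewrite [leLHS]integral_mkcond; apply: ge0_le_integral => //.
- by move=> w _; apply: erestrict_ge0 => v _; rewrite lee_fin.
- apply/(measurable_restrictT _ _).1; first exact: measurableD.
  by apply: measurable_funS (@subsetT _ _) _ => //; exact/measurable_EFinP.
- apply/(measurable_restrictT _ _).1; first exact: measurableD.
  exact: measurable_funS (@subsetT _ _) mU.
move=> w _; rewrite !patchE; have := hY w; rewrite patchE.
case: (boolP (w \in N)) => wN.
  by move=> _; rewrite !memNset//= => -[_]; apply; exact/set_mem.
have nNw : ~ N w by rewrite notin_setE in wN.
rewrite (mem_set (conj Logic.I nNw : (setT `\` N) w)).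
case: (boolP (w \in D)) => wD hw.
  rewrite mem_set; last by split => //; exact/set_mem.
  exact: le_trans hw (nN w nNw).
by rewrite memNset// => -[/mem_set]; rewrite (negbTE wD).
Qed.

(** If a version [Z] exceeded the bound on a non-null set of [G], integrating both over that set
    would contradict the test inequality for [Psi], applied to [xi1] cut down to this set. *)
Lemma cond_expectation_le_affine (G : set (set T)) (Y Psi : T -> \bar R)
    (xi0 xi1 : T -> R) (c : R) :
  sigma_algebra setT G -> G `<=` measurable -> (0 <= c)%R ->
  (forall w, 0 <= Y w) ->
  measurable_fun (setT : set (g_sigma_algebraType G)) xi0 ->
  measurable_fun (setT : set (g_sigma_algebraType G)) xi1 ->
  (forall w, 0 <= xi0 w)%R -> (forall w, 0 <= xi1 w)%R ->
  measurable_fun setT Psi -> (forall w, 0 <= Psi w) ->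
  (forall xi : T -> R, measurable_fun (setT : set (g_sigma_algebraType G)) xi ->
     (forall w, 0 <= xi w)%R ->
     \int[P]_w ((xi w)%:E * Psi w) <= \int[P]_w (xi w)%:E * c%:E) ->
  {ae P, forall w, Y w <= (xi0 w)%:E + (xi1 w)%:E * Psi w} ->
  cond_expectation_le P G Y (fun w => (xi0 w + xi1 w * c)%:E).
Proof.
move=> sG Gm c0 Y0 mxi0 mxi1 xi00 xi10 mPsi Psi0 hPsi hY Z [mZ ZY].
have GE : <<s G >> = G by exact: sigma_algebra_id.
have mZ' : measurable_fun (setT : set (g_sigma_algebraType G)) Z.
  by move=> _ B mB; rewrite setTI; apply: sub_sigma_algebra; exact: mZ.
have fromG (f : T -> R) : measurable_fun (setT : set (g_sigma_algebraType G)) f ->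
    measurable_fun setT f by exact: measurable_fun_from_sigma.
pose B w := (xi0 w + xi1 w * c)%R.
have mB : measurable_fun (setT : set (g_sigma_algebraType G)) B.
  by apply: measurable_funD => //; exact: measurable_funM.
have B0 w : (0 <= B w)%R by rewrite addr_ge0// mulr_ge0.
(* The margin [1 / (n + 1)] turns the strict excess into a quantity that can be integrated; the
   cutoff [B <= n] makes the integral of [B] finite, so that it can be subtracted. The sets [D n]
   cover all points with [B < Z]. *)
pose D n := [set w | (B w + n.+1%:R^-1)%:E <= Z w] `&` [set w | (B w)%:E <= n%:R%:E].
have mD n : (measurable : set (set (g_sigma_algebraType G))) (D n).
  apply: measurableI; rewrite -[X in measurable X]setTI; apply: measurable_lee => //.
  - by apply/measurable_EFinP; exact: measurable_funD.
  - exact/measurable_EFinP.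
have GD n : G (D n) by rewrite -GE; exact: mD.
have PD n : P (D n) = 0.
  have mDn : measurable (D n) by exact: Gm.
  have mDG : (measurable : set (set (g_sigma_algebraType G))) (D n) by exact: mD.
  have int_res (xi : T -> R) (Phi : T -> \bar R) :
      \int[P]_(w in D n) ((xi w)%:E * Phi w) =
      \int[P]_w ((if w \in D n then xi w else 0%R)%:E * Phi w).
    rewrite integral_mkcond; apply: eq_integral => w _; rewrite patchE.
    by case: ifP => // _; rewrite mul0e.
  have m1 : measurable_fun (setT : set (g_sigma_algebraType G))
      (fun w => if w \in D n then xi1 w else 0%R).
    exact: measurable_fun_if_mem.
  have up : \int[P]_(w in D n) Z w <= \int[P]_(w in D n) (B w)%:E.
    rewrite (ZY _ (GD n)).
    apply: (@le_trans _ _ (\int[P]_(w in D n) ((xi0 w)%:E + (xi1 w)%:E * Psi w))).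
      apply: le_integral_nonmeasurable => //.
      - apply: emeasurable_funD; first by apply/measurable_EFinP; exact: fromG.
        apply: emeasurable_funM => //; apply/measurable_EFinP; exact: fromG.
      - by move=> w; rewrite adde_ge0 ?mule_ge0 ?lee_fin.
    have mxi0' : measurable_fun (D n) (EFin \o xi0).
      by apply/measurable_EFinP/measurable_funTS; exact: fromG.
    have mxi1' : measurable_fun (D n) (EFin \o xi1).
      by apply/measurable_EFinP/measurable_funTS; exact: fromG.
    rewrite ge0_integralD//; first last.
    - by apply: emeasurable_funM => //; exact: measurable_funTS.
    - by move=> w _; rewrite mule_ge0 ?lee_fin.
    - by move=> w _; rewrite lee_fin.
    have -> : \int[P]_(w in D n) (B w)%:E =
       \int[P]_(w in D n) (xi0 w)%:E + \int[P]_(w in D n) ((xi1 w)%:E * c%:E).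
      rewrite -ge0_integralD//; first last.
      - by apply: emeasurable_funM.
      - by move=> w _; rewrite mule_ge0 ?lee_fin.
      - by move=> w _; rewrite lee_fin.
    apply: leeD => //; rewrite (int_res xi1 Psi) [leRHS](int_res xi1 (cst c%:E)).
    apply: le_trans (hPsi _ m1 _) _; first by move=> w; case: ifP.
    rewrite ge0_integralZr//.
    - by apply/measurable_EFinP; exact: fromG.
    - by move=> w _; rewrite lee_fin; case: ifP.
  have mBD : measurable_fun (D n) (EFin \o B).
    by apply/measurable_EFinP/measurable_funTS; exact: fromG.
  have low : \int[P]_(w in D n) (B w)%:E + (n.+1%:R^-1)%:E * P (D n) <=
      \int[P]_(w in D n) Z w.
    rewrite -integral_cst// -ge0_integralD//; last 2 first.
    - by move=> w _; rewrite lee_fin.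
    - by move=> w _; rewrite lee_fin.
    apply: ge0_le_integral => //.
    - by move=> w _; rewrite adde_ge0 ?lee_fin.
    - by apply: emeasurable_funD.
    - apply: measurable_funTS; exact: measurable_fun_from_sigma mZ'.
    - by move=> w [].
  have Bfin : \int[P]_(w in D n) (B w)%:E \is a fin_num.
    rewrite ge0_fin_numE; last by apply: integral_ge0 => w _; rewrite lee_fin.
    apply: (@le_lt_trans _ _ (\int[P]_(w in D n) (cst n%:R%:E w))).
      apply: ge0_le_integral => //.
      - by move=> w _; rewrite lee_fin.
      - by move=> w [].
    rewrite integral_cst// (le_lt_trans _ (ltry n%:R))//.
    by rewrite -[leRHS]mule1 lee_wpmul2l ?lee_fin// probability_le1.
  have := le_trans low up; rewrite -leeBrDl// subee//.
  rewrite pmule_rle0 ?lte_fin ?invr_gt0// => h.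
  by apply/eqP; rewrite eq_le h measure_ge0.
have : P.-negligible (\bigcup_n D n).
  by apply: negligible_bigcup => n; apply/negligibleP; [exact: Gm (GD n)|exact: PD].
apply: negligibleS => w /= /negP; rewrite -ltNge => BZ.
have [e e0 BeZ] : exists2 e : R, (0 < e)%R & (B w + e)%:E <= Z w.
  case: (Z w) BZ => [z| |]//; rewrite ?lte_fin => Bz.
  - by exists (z - B w)%R; rewrite ?subr_gt0// lee_fin addrC subrK.
  - by exists 1%R; rewrite ?leey.
pose n := maxn (Num.truncn e^-1) (Num.truncn (B w)).+1.
exists n => //; split => /=.
  apply: le_trans BeZ; rewrite lee_fin lerD2l invf_ple ?posrE//.
  rewrite (le_trans (ltW (truncnS_gt _)))// ler_nat ltnS.
  exact: leq_maxl.
rewrite lee_fin (le_trans (ltW (truncnS_gt _)))// ler_nat.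
exact: leq_maxr.
Qed.

End ConditionalBound.

(** * Measurability of the residual work and lifetime *)

Section InitialDataMeasurability.
Context {d : measure_display} {T : measurableType d} {R : realType}.

(** Used for sums and maxima with a random number of terms, as the numbers of clusters and of events
    are part of the random state: the space is cut along the values of [n]. *)
Lemma measurable_fun_nat_index {d' : measure_display} {U : measurableType d'}
    (n : U -> nat) (G : nat -> U -> R) :
  measurable_fun setT (fun w => (n w)%:R : R) ->
  (forall k, measurable_fun setT (G k)) ->
  measurable_fun setT (fun w => G (n w) w).
Proof.
move=> mn mG _ B mB; rewrite setTI.
have -> : (fun w => G (n w) w) @^-1` B =
    \bigcup_k (((fun w => (n w)%:R : R) @^-1` [set k%:R]) `&` (G k @^-1` B)).
  rewrite predeqE => w; split=> [h|[k _ [/= /eqP]]]; first by exists (n w).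
  by rewrite eqr_nat => /eqP ->.
apply: bigcupT_measurable => k; apply: measurableI.
  by rewrite -[X in measurable X]setTI; exact: mn.
by rewrite -[X in measurable X]setTI; exact: mG.
Qed.

Variables (S : 'I_2 -> T -> state R) (i : 'I_2).
Let U : measurableType _ := g_sigma_algebraType (F0 S).
Let c l w := nth [::] (memory0 (S i w)) l.

Lemma measurable_state_coord x :
  measurable_fun (setT : set U) (fun w => state_coord x (S i w)).
Proof.
move=> _ B mB; do 2 apply: sub_sigma_algebra.
by exists (i, x) => //; exists B.
Qed.

Lemma measurable_residual_job_size :
  measurable_fun (setT : set U) (fun w => residual_job_size (S i w)).
Proof.
pose g l k (w : U) : R := if w \in [set w | 0 <= ev_time (ev (c l w) k)]
  then ev_job (ev (c l w) k) else 0.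
rewrite (_ : (fun w => _) = (fun w => \sum_(l < size (memory0 (S i w)))
    \sum_(k < size (c l w)) g l k w)); last first.
  apply/funext => w; rewrite /residual_job_size big_mkcond big_flatten.
  rewrite (big_nth [::]) big_mkord; apply: eq_bigr => l _.
  rewrite (big_nth (Event 0 0 0)) big_mkord; apply: eq_bigr => k _.
  by rewrite /g mem_setE.
apply: (@measurable_fun_nat_index _ U (fun w => size (memory0 (S i w)))
  (fun n w => \sum_(l < n) \sum_(k < size (c l w)) g l k w)).
  exact: (measurable_state_coord NbClusters).
move=> n; apply: measurable_sum => l.
apply: (@measurable_fun_nat_index _ U (fun w => size (c l w))
  (fun k w => \sum_(j < k) g l j w)).
  exact: (measurable_state_coord (NbEvents l)).
move=> n'; apply: measurable_sum => k; apply: measurable_fun_if_mem => //.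
- rewrite (_ : mkset _ = (fun w => ev_time (ev (c l w) k)) @^-1` `[0, +oo[%classic).
    rewrite -[X in measurable X]setTI.
    by apply: (measurable_state_coord (EvTime l k)) => //; exact: measurable_itv.
  by rewrite predeqE => w /=; rewrite in_itv/= andbT.
- exact: (measurable_state_coord (EvJob l k)).
Qed.

Lemma bigmax_flatten (s : seq (event_list R)) :
  \big[Num.max/0]_(e <- flatten s) ev_time e =
  \big[Num.max/0]_(c <- s) \big[Num.max/0]_(e <- c) ev_time e :> R.
Proof.
have ge0 (r : event_list R) : 0 <= \big[Num.max/0]_(e <- r) ev_time e.
  by elim/big_rec: _ => // e x _ x0; rewrite le_max x0 orbT.
elim: s => [|c' s IH] /=; first by rewrite !big_nil.
rewrite big_cons -IH; elim: c' => [|e c' IHc] /=.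
  by rewrite big_nil max_r// ge0.
by rewrite !big_cons IHc maxA.
Qed.

Lemma measurable_bigmax (g : nat -> U -> R) (n : nat) :
  (forall k, measurable_fun setT (g k)) ->
  measurable_fun setT (fun w => \big[Num.max/0]_(k < n) g k w).
Proof.
move=> mg;
  rewrite (_ : (fun _ => _) = (fun w => \big[Num.max/0]_(k <- iota 0 n) g k w)).
  elim: (iota 0 n) => [|k s IH].
    by rewrite (_ : (fun _ => _) = cst 0)//; apply/funext => w; rewrite big_nil.
  rewrite (_ : (fun _ => _) = (fun w => Num.max (g k w) (\big[Num.max/0]_(k <- s) g k w))).
    exact: measurable_maxr.
  by apply/funext => w; rewrite big_cons.
apply/funext => w; rewrite -(big_mkord xpredT (fun k => g k w)).
by rewrite /index_iota subn0.
Qed.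

Lemma measurable_residual_lifetime :
  measurable_fun (setT : set U) (fun w => residual_lifetime (S i w)).
Proof.
rewrite (_ : (fun w => _) = (fun w => \big[Num.max/0]_(l < size (memory0 (S i w)))
    \big[Num.max/0]_(k < size (c l w)) ev_time (ev (c l w) k))); last first.
  apply/funext => w; rewrite /residual_lifetime bigmax_flatten.
  rewrite (big_nth [::]) big_mkord; apply: eq_bigr => l _.
  by rewrite (big_nth (Event 0 0 0)) big_mkord.
apply: (@measurable_fun_nat_index _ U (fun w => size (memory0 (S i w)))
  (fun n w => \big[Num.max/0]_(l < n) \big[Num.max/0]_(k < size (c l w))
     ev_time (ev (c l w) k))).
  exact: (measurable_state_coord NbClusters).
move=> n; apply: (@measurable_bigmax (fun l w => \big[Num.max/0]_(k < size (c l w))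
  ev_time (ev (c l w) k))) => l.
apply: (@measurable_fun_nat_index _ U (fun w => size (c l w))
  (fun n w => \big[Num.max/0]_(k < n) ev_time (ev (c l w) k))).
  exact: (measurable_state_coord (NbEvents l)).
move=> n'; apply: (@measurable_bigmax (fun k w => ev_time (ev (c l w) k))) => k.
exact: (measurable_state_coord (EvTime l k)).
Qed.

End InitialDataMeasurability.

(** * Choice of the constants *)

Section Constants.
Context {R : realType}.

(** From [exp(- y) >= 1 - y] follows [exp y <= 1 + y * exp y]; this inequality is inserted into
    itself once. *)
Lemma expR_le_taylor2 (y : R) : 0 <= y -> expR y <= 1 + y + y ^+ 2 * expR y.
Proof.
move=> y0; have e0 := expR_gt0 y.
have h : expR y <= 1 + y * expR y.
  have : expR y * (1 - y) <= expR y * expR (- y).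
    by rewrite ler_pM2l//; exact: expR_ge1Dx.
  by rewrite -expRD subrr expR0; lra.
have := ler_wpM2l y0 h; lra.
Qed.

(** Half of the exponent [v * s] pays for [exp(v * theta)], the other half for the factor [v ^+ 2].
    The constant 16 comes from squaring [y <= exp y] at [y = v * s / 4]. *)
Lemma expR_scale_le (s theta v : R) : 0 < s -> 0 <= theta <= s / 2 -> 0 <= v ->
  expR (v * theta) <= 1 + theta * v + theta ^+ 2 * (16 / s ^+ 2) * expR (v * s).
Proof.
move=> s0 /andP[t0 ts] v0.
have vt0 : 0 <= v * theta by rewrite mulr_ge0.
apply: le_trans (expR_le_taylor2 vt0) _.
rewrite [v * theta]mulrC lerD2l.
have vs : v ^+ 2 <= 16 / s ^+ 2 * expR (v * s / 2).
  have h : v * s / 4 <= expR (v * s / 4).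
    by apply: le_trans (expR_ge1Dx _); rewrite lerDr.
  have h0 : 0 <= v * s / 4 by rewrite !mulr_ge0// ltW.
  have : (v * s / 4) ^+ 2 <= expR (v * s / 4) ^+ 2 by rewrite ler_pXn2r ?nnegrE// expR_ge0.
  rewrite -expRM_natl (_ : 2 * (v * s / 4) = v * s / 2); last by lra.
  move=> h2.
  have -> : v ^+ 2 = 16 / s ^+ 2 * (v * s / 4) ^+ 2 by field; rewrite gt_eqF.
  by rewrite ler_wpM2l// divr_ge0// sqr_ge0.
have tv : expR (theta * v) <= expR (v * s / 2).
  by rewrite ler_expR mulrC -mulrA ler_wpM2l.
have -> : expR (v * s) = expR (v * s / 2) * expR (v * s / 2).
  by rewrite -expRD; congr expR; lra.
rewrite exprMn -!(mulrA (theta ^+ 2)) ler_wpM2l ?sqr_ge0// [leRHS]mulrA.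
by apply: ler_pM => //; exact: sqr_ge0.
Qed.

Context {d0 : measure_display} {O : measurableType d0}.
Variable Q : probability O R.
Variable V : {RV Q >-> R}.
Hypothesis V_gt0 : {ae Q, forall x, 0 < V x}.
Hypothesis V_mean : ('E_Q[V] = 1)%E.

Lemma mgf_le_quadratic (s : R) : 0 < s -> ('M_Q V s < +oo)%E ->
  exists2 K : R, 0 <= K & forall theta, 0 <= theta <= s / 2 ->
    ('M_Q V theta <= (1 + theta + theta ^+ 2 * K)%:E)%E.
Proof.
move=> s0 Ms; rewrite /mmt_gen_fun unlock in Ms *.
have mV : measurable_fun setT V by [].
have mexp r : measurable_fun setT (fun w => (expR (V w * r))%:E).
  by apply/measurable_EFinP; apply: measurableT_comp => //; exact: measurable_funM.
(* The absolute value keeps the integrand nonnegative everywhere, while [V] is positive only almost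
   surely. *)
have V1 : (\int[Q]_w (`|V w|)%:E = 1)%E.
  rewrite -V_mean unlock; apply: ae_eq_integral => //.
  - by apply/measurable_EFinP; exact: measurableT_comp.
  - exact/measurable_EFinP.
  by apply: filterS V_gt0 => w Vw _; rewrite ger0_norm// ltW.
pose I := fine (\int[Q]_w (expR (V w * s))%:E)%E.
have IE : (\int[Q]_w (expR (V w * s))%:E = I%:E)%E.
  by rewrite /I fineK// ge0_fin_numE// integral_ge0// => w _; rewrite lee_fin expR_ge0.
have I0 : 0 <= I by rewrite -lee_fin -IE integral_ge0// => w _;
  rewrite lee_fin expR_ge0.
exists (16 / s ^+ 2 * I); first by rewrite mulr_ge0// divr_ge0// sqr_ge0.
move=> theta /[dup] ths /andP[th0 _].
pose q := theta ^+ 2 * (16 / s ^+ 2).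
have q0 : 0 <= q by rewrite mulr_ge0 ?sqr_ge0// divr_ge0// sqr_ge0.
have mn : measurable_fun setT (fun w => (`|V w|)%:E).
  by apply/measurable_EFinP; exact: measurableT_comp.
apply: (@le_trans _ _ (\int[Q]_w (1%:E + theta%:E * (`|V w|)%:E +
    q%:E * (expR (V w * s))%:E))%E).
  apply: ae_ge0_le_integral => //.
  - by move=> w _; rewrite lee_fin expR_ge0.
  - exact: mexp.
  - by move=> w _; rewrite !adde_ge0 ?mule_ge0 ?lee_fin ?expR_ge0.
  - apply: emeasurable_funD; last exact: emeasurable_funM.
    by apply: emeasurable_funD => //; exact: emeasurable_funM.
  - apply: filterS V_gt0 => w Vw _.
    rewrite -!EFinM -!EFinD lee_fin ger0_norm ?(ltW Vw)//.
    by apply: expR_scale_le => //; exact: ltW.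
rewrite ge0_integralD//; first last.
- exact: emeasurable_funM.
- by move=> w _; rewrite mule_ge0 ?lee_fin ?expR_ge0.
- by apply: emeasurable_funD => //; exact: emeasurable_funM.
- by move=> w _; rewrite adde_ge0 ?mule_ge0 ?lee_fin.
rewrite ge0_integralD//; first last.
- exact: emeasurable_funM.
- by move=> w _; rewrite mule_ge0 ?lee_fin.
rewrite !ge0_integralZl//; try by move=> w _; rewrite lee_fin ?expR_ge0.
rewrite V1 IE (integral_cst Q measurableT 1%:E) [X in (_ * X)%E]probability_setT.
by rewrite !mule1 lee_fin /q !mulrA.
Qed.

(** To first order in [theta] the inequality reads [1 + m * c < c], which is the assumption on [c];
    the quadratic bound on the moment generating function controls the rest. *)
Lemma exists_theta (m c : R) : 0 < m -> 0 < c -> 1 < c * (1 - m) ->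
  (\forall s \near (0 : R), ('M_Q V s < +oo)%E) ->
  exists2 theta : R, 0 < theta &
    ('M_Q V theta * (expR (m * (1 + c * theta - 1)))%:E <= (1 + c * theta)%:E)%E.
Proof.
move=> m0 c0 cm [e /= e0 he].
pose s := e / 2; have s0 : 0 < s by rewrite divr_gt0.
have Ms : ('M_Q V s < +oo)%E.
  by apply: he; rewrite /= sub0r normrN gtr0_norm// /s; lra.
have [K K0 hK] := mgf_le_quadratic s0 Ms.
pose D := K + m * c ^+ 2 + 1.
have D0 : 0 < D by rewrite /D; have := mulr_gt0 m0 (exprn_gt0 2 c0); lra.
(* The first term keeps [theta] in the range of the quadratic bound; the second makes the
   second-order terms at most the first-order gain [c * (1 - m) - 1]. *)
pose theta := Num.min (s / 2) ((c * (1 - m) - 1) / D).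
have th0 : 0 < theta by rewrite lt_min !divr_gt0//; lra.
have ths : 0 <= theta <= s / 2 by rewrite ltW//= ge_min lexx.
have thD : theta * D <= c * (1 - m) - 1.
  by rewrite -ler_pdivlMr// ge_min lexx orbT.
exists theta => //.
apply: (@le_trans _ _ ((1 + theta + theta ^+ 2 * K) * expR (m * (c * theta)))%:E).
  rewrite EFinM (_ : 1 + c * theta - 1 = c * theta); last by lra.
  by apply: lee_wpmul2r (hK _ ths); rewrite lee_fin expR_ge0.
rewrite lee_fin -ler_pdivlMr ?expR_gt0// -expRN.
(* With the exponential moved to the right, [exp(- y) >= 1 - y] leaves a polynomial inequality in
   [theta]. *)
apply: (@le_trans _ _ ((1 + c * theta) * (1 - m * (c * theta)))).
  have : theta * (theta * D) <= theta * (c * (1 - m) - 1) by rewrite ler_pM2l.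
  rewrite /D; have : 0 <= theta * theta by rewrite mulr_ge0 ?ltW.
  move=> tt; have -> : (1 + c * theta) * (1 - m * (c * theta)) =
    1 + c * (1 - m) * theta - m * c ^+ 2 * theta ^+ 2 by ring.
  nra.
by apply: ler_wpM2l (expR_ge1Dx _); rewrite addr_ge0// mulr_ge0// ltW.
Qed.

End Constants.

(** * Exponential decay *)

Section DecayBound.
Context {d : measure_display} {T : measurableType d} {R : realType}.
Variable P : probability T R.
Variable C : clusters P.
Variable S : 'I_2 -> T -> state R.
Variables (lambda0 m c mu eta theta : R) (f : R -> R).
Context {d0 : measure_display} {O : measurableType d0}.
Variable Q : probability O R.
Variables b V : {RV Q >-> R}.
Hypothesis coupled : semi_synchronously_coupled lambda0 m f V C S.
Hypothesis V_gt0 : {ae Q, forall x, 0 < V x}.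
Hypothesis m_gt0 : 0 < m.
Hypothesis lambda0_gt0 : 0 < lambda0.
Hypothesis b_ge0 : {ae Q, forall x, 0 <= b x}.
Hypothesis b_density : has_density b f.
Hypothesis c_ge0 : 0 <= c.
Hypothesis theta_gt0 : 0 < theta.
Hypothesis eta_gt0 : 0 < eta.
Hypothesis mu_gt0 : 0 < mu.
Hypothesis V_mgf :
  ('M_Q V theta * (expR (m * (1 + c * theta - 1)))%:E <= (1 + c * theta)%:E)%E.
Hypothesis drift : lambda0 * c * theta + eta * mu <= theta * mu.

(** Common to workloads and busy times: [Y] is bounded by a function [D] of the initial data and
    vanishes when both systems are drained. If system [i] is not drained, then
    [1 <= g i * exp(theta A(t))]. By [drift], the service [theta * mu * t] in [g i] absorbs the
    growth [lambda0 * c * theta * t] of the moment bound [M] and leaves [eta * mu * t]. *)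
Lemma cond_expectation_le_decay (t : R) (Y D : T -> R) : 0 <= t ->
  measurable_fun (setT : set (g_sigma_algebraType (F0 S))) D ->
  (forall w, 0 <= D w) -> (forall w, 0 <= Y w) ->
  (forall w, regular_outcome C w -> (shared_work C t w < +oo)%E ->
    Y w <= D w /\ ((forall i, drained C w mu t S i) -> Y w = 0)) ->
  cond_expectation_le P (F0 S) (fun w => (Y w)%:E)
    (fun w => (D w * decay_bound mu eta theta S t w)%:E).
Proof.
move=> t0 mD D0 Y0 hY.
have x1 : 1 <= 1 + c * theta by rewrite lerDl mulr_ge0// ltW.
have [Psi [mPsi Psi0 hPsi aePsi]] := exp_shared_work_bound coupled V_gt0 m_gt0
  lambda0_gt0 b_ge0 b_density theta_gt0 x1 V_mgf t0.
pose M := expR (lambda0 * t * (1 + c * theta - 1)).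
have M0 : 0 < M by exact: expR_gt0.
pose k i w := workload0 (S i w) + residual_job_size (S i w)
  + mu * residual_lifetime (S i w).
pose g i w := expR (theta * (k i w - mu * t)).
have g0 i w : 0 < g i w by exact: expR_gt0.
have mg i : measurable_fun (setT : set (g_sigma_algebraType (F0 S))) (g i).
  apply: measurableT_comp => //; apply: measurable_funM => //.
  apply: measurable_funB => //; apply: measurable_funD.
    apply: measurable_funD; first exact: (@measurable_state_coord _ _ _ S i Workload).
    exact: measurable_residual_job_size.
  by apply: measurable_funM => //; exact: measurable_residual_lifetime.
pose N i := [set w | 1 <= g i w * M].
have mN i : (measurable : set (set (g_sigma_algebraType (F0 S)))) (N i).
  rewrite (_ : N i = (fun w => g i w * M) @^-1` `[1, +oo[%classic); last first.
    by rewrite predeqE => w /=; rewrite in_itv/= andbT.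
  rewrite -[X in measurable X]setTI.
  have mgM : measurable_fun (setT : set (g_sigma_algebraType (F0 S))) (fun w => g i w * M).
    exact: measurable_funM.
  by apply: mgM => //; exact: measurable_itv.
pose xi0 w := D w * \sum_(i < 2) (if w \in N i then 1 else 0).
pose xi1 w := D w * \sum_(i < 2) (if w \in N i then 0 else g i w).
have s0 w : 0 <= \sum_(i < 2) (if w \in N i then 1 else 0) :> R.
  by apply: sumr_ge0 => i _; case: ifP.
have s1 w : 0 <= \sum_(i < 2) (if w \in N i then 0 else g i w).
  by apply: sumr_ge0 => i _; case: ifP => // _; exact: ltW.
have mxi0 : measurable_fun (setT : set (g_sigma_algebraType (F0 S))) xi0.
  by apply: measurable_funM => //; apply: measurable_sum => i;
    exact: measurable_fun_if_mem.
have mxi1 : measurable_fun (setT : set (g_sigma_algebraType (F0 S))) xi1.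
  by apply: measurable_funM => //; apply: measurable_sum => i;
    exact: measurable_fun_if_mem.
have F0m : F0 S `<=` measurable := @source_sigma_measurable _ _ _ _ _ _ _ _ _ _ _ _ _ coupled Initial.
have key : cond_expectation_le P (F0 S) (fun w => (Y w)%:E)
    (fun w => (xi0 w + xi1 w * M)%:E).
  apply: (@cond_expectation_le_affine _ _ _ P (F0 S) _ Psi) => //.
  - exact: sigma_of_algebra.
  - exact: ltW.
  - by move=> w; rewrite mulr_ge0.
  - by move=> w; rewrite mulr_ge0.
  apply: filterS aePsi => w [rw Aw hw].
  have [YD Yz] := hY w rw Aw.
  have e0 : (0 <= (xi0 w)%:E + (xi1 w)%:E * Psi w)%E.
    by rewrite adde_ge0 ?mule_ge0 ?lee_fin ?mulr_ge0.
  case: (pselect (forall i, drained C w mu t S i)) => [/Yz -> //|].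
  move=> /existsNP[i nEi].
  have kA : 0 <= k i w + (fine (shared_work C t w) - mu * t).
    by move/negP : nEi; rewrite -leNgt.
  apply: (@le_trans _ _ (D w)%:E); first by rewrite lee_fin.
  apply: (@le_trans _ _ (xi0 w + xi1 w * expR (theta * fine (shared_work C t w)))%:E).
    rewrite lee_fin /xi0 /xi1 -mulrA -mulrDr -[leLHS]mulr1 ler_wpM2l//.
    rewrite mulr_suml -big_split/=.
    rewrite (bigD1 i)//= -[leLHS]addr0; apply: lerD; last first.
      apply: sumr_ge0 => j _; rewrite addr_ge0//; first by case: ifP.
      by rewrite mulr_ge0 ?expR_ge0//; case: ifP => // _; exact: ltW.
    case: ifP => _; first by rewrite mul0r addr0.
    rewrite add0r /g -expRD -mulrDr -[leLHS]expR0 ler_expR mulr_ge0 ?(ltW theta_gt0)//.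
    by move: kA; rewrite addrA addrAC.
  by rewrite EFinD leeD2lE// EFinM lee_wpmul2l// lee_fin mulr_ge0.
move=> Z /key; apply: filterS => w /le_trans; apply.
rewrite lee_fin /xi0 /xi1 /decay_bound -mulrA -mulrDr ler_wpM2l//.
rewrite mulr_suml -big_split/=; apply: ler_sum => i _.
have L0 : 0 <= residual_lifetime (S i w) by exact: residual_lifetime_ge0.
set E := (X in Num.max X 0).
have muL : 0 <= mu * residual_lifetime (S i w) by rewrite mulr_ge0// ltW.
(* The estimate yields [theta * mu * L] in the exponent; the stated coefficient [eta + 2 * theta]
   leaves a nonnegative surplus [(eta + theta) * mu * L]. *)
have gM : g i w * M <= expR (- E).
  rewrite /g /M -expRD ler_expR /k /E.
  have := ler_wpM2l t0 drift.
  have := mulr_ge0 (ltW eta_gt0) muL; have := mulr_ge0 (ltW theta_gt0) muL; lra.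
have g1 : expR (- Num.max E 0) = Num.min (expR (- E)) 1.
  case: (leP E 0) => E0.
    by rewrite min_r ?oppr0 ?expR0// -[leLHS]expR0 ler_expR oppr_ge0.
  by rewrite min_l// -[leRHS]expR0 ler_expR oppr_le0 ltW.
rewrite g1; case: ifPn => [|]; rewrite ?notin_setE.
  by move=> /set_mem; rewrite /N /= => h;
    rewrite mul0r addr0 le_min lexx andbT (le_trans h).
by rewrite /N /= => /negP; rewrite -ltNge => h; rewrite add0r le_min gM ltW.
Qed.

End DecayBound.

Theorem theorem2 (R : realType)
  (lambda0 m mu_lo mu_hi eps : R) (f g : R -> R)
  (d0 : measure_display) (O : measurableType d0) (Q : probability O R)
  (b V : {RV Q >-> R})
  (lambda0_gt0 : 0 < lambda0) (m_gt0 : 0 < m) (m_lt1 : m < 1)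
  (eps_gt0 : 0 < eps) (mu_lo_gt0 : 0 < mu_lo)
  (stable : lambda0 * fine 'E_Q[V] / (1 - m) < mu_lo - eps)
  (b_ge0 : {ae Q, forall x, 0 <= b x})
  (b_density : has_density b f)
  (f_cont : {in `]0, +oo[, continuous f})
  (b_mgf : exists2 s : R, 0 < s & ('M_Q b s < +oo)%E)
  (V_gt0 : {ae Q, forall x, 0 < V x})
  (V_density : has_density V g)
  (g_cont : {in `]0, +oo[, continuous g})
  (V_mean : ('E_Q[V] = 1)%E)
  (V_mgf : \forall s \near (0 : R), ('M_Q V s < +oo)%E) :
  exists eta theta : R, [/\ 0 < eta, 0 < theta &
    forall (d : measure_display) (T : measurableType d) (P : probability T R)
      (mu : R) (C : clusters P) (S : 'I_2 -> T -> state R),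
    mu_lo <= mu <= mu_hi ->
    semi_synchronously_coupled lambda0 m f V C S ->
    forall p t : R, 1 <= p -> 0 <= t ->
      cond_expectation_le P (F0 S)
        (fun w =>
          (`|workload mu C (S 0) t w - workload mu C (S 1) t w| `^ p)%:E)
        (fun w =>
          (initial_gap S w `^ p * decay_bound mu eta theta S t w)%:E)
      /\
      cond_expectation_le P (F0 S)
        (fun w =>
          (`|observed_busy mu C (S 0) t w - observed_busy mu C (S 1) t w|
             `^ p)%:E)
        (fun w =>
          ((busy0 (S 0 w) + busy0 (S 1 w) + t) `^ p
             * decay_bound mu eta theta S t w)%:E)].
Proof.
have c_def : lambda0 / (1 - m) < mu_lo - eps.
  by move: stable; rewrite V_mean /= mulr1.
pose c := (mu_lo - eps) / lambda0.
have m1 : 0 < 1 - m by rewrite subr_gt0.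
have mueps : 0 < mu_lo - eps by apply: lt_trans c_def; rewrite divr_gt0.
have c0 : 0 < c by rewrite divr_gt0.
have cm : 1 < c * (1 - m).
  by rewrite -ltr_pdivrMr// ltr_pdivlMr// mulrC mul1r.
have [theta theta0 V_theta] := exists_theta V_gt0 V_mean m_gt0 c0 cm V_mgf.
(* Since [lambda0 * c = mu_lo - eps], the drift condition asks for
   [eta * mu <= theta * (mu - mu_lo + eps)]. This value gives equality at [mu = mu_lo], and it
   serves every larger [mu] because [eps < mu_lo]. *)
pose eta := theta * eps / mu_lo.
have eta0 : 0 < eta by rewrite !mulr_gt0// invr_gt0.
exists eta, theta; split => // d T P mu C S /andP[mu_lo_mu _] coupled p t p1 t0.
have mu0 : 0 < mu by exact: lt_le_trans mu_lo_mu.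
have drift : lambda0 * c * theta + eta * mu <= theta * mu.
  have -> : lambda0 * c = mu_lo - eps by rewrite /c mulrC divfK// gt_eqF.
  have h : eps / mu_lo * (mu - mu_lo) <= mu - mu_lo.
    by rewrite ler_piMl ?subr_ge0// ler_pdivrMr// mul1r; lra.
  have -> : eta * mu = theta * (eps / mu_lo * (mu - mu_lo) + eps).
    by rewrite /eta; field; rewrite gt_eqF.
  rewrite -mulrC -mulrDr ler_pM2l//; lra.
have p0 : 0 <= p by exact: le_trans p1.
(* Coupled systems contribute the [p]-th power of 0, which is 0 only for nonzero [p]. *)
have p_neq0 : p != 0 by rewrite gt_eqF// (lt_le_trans ltr01).
have valid := ssc_valid coupled.
have J0 i w : 0 <= residual_job_size (S i w).
  exact: le_trans (memory_work_ge0 (valid i w) 0) (memory_work_le (valid i w) 0).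
have gap0 w : 0 <= initial_gap S w by rewrite /initial_gap addr_ge0// le_max J0.
have X0 i w : 0 <= busy0 (S i w) by case: (valid i w).
split.
- apply: (cond_expectation_le_decay coupled V_gt0 m_gt0 lambda0_gt0 b_ge0 b_density
    (ltW c0) theta0 eta0 mu0 V_theta drift t0
    (D := fun w => initial_gap S w `^ p)) => //.
  + suff mgap : measurable_fun (setT : set (g_sigma_algebraType (F0 S))) (initial_gap S).
      exact: (measurableT_comp (@measurable_powR R p) mgap).
    apply: measurable_funD; last by apply: measurable_maxr;
      exact: measurable_residual_job_size.
    apply: measurableT_comp => //.
    by apply: measurable_funB; [exact: (@measurable_state_coord _ _ _ S 0 Workload)|
      exact: (@measurable_state_coord _ _ _ S 1 Workload)].
  + by move=> w; exact: powR_ge0.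
  move=> w rw Aw; split.
    apply: (ge0_ler_powR p0); rewrite ?nnegrE//.
    rewrite ler_norml; apply/andP; split.
      have := workload_gap rw mu0 t0 (valid ^~ w) 1 0.
      by rewrite /initial_gap distrC maxC; lra.
    exact: (workload_gap rw mu0 t0 (valid ^~ w) 0 1).
  move=> E; rewrite !(workload_drained rw mu0 t0 (valid ^~ w))//.
  by rewrite subrr normr0 powR0.
apply: (cond_expectation_le_decay coupled V_gt0 m_gt0 lambda0_gt0 b_ge0 b_density
    (ltW c0) theta0 eta0 mu0 V_theta drift t0
    (D := fun w => (busy0 (S 0 w) + busy0 (S 1 w) + t) `^ p)) => //.
+ suff mX : measurable_fun (setT : set (g_sigma_algebraType (F0 S)))
      (fun w => busy0 (S 0 w) + busy0 (S 1 w) + t).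
    exact: (measurableT_comp (@measurable_powR R p) mX).
  apply: measurable_funD => //.
  by apply: measurable_funD; [exact: (@measurable_state_coord _ _ _ S 0 BusyTime)|
      exact: (@measurable_state_coord _ _ _ S 1 BusyTime)].
+ by move=> w; exact: powR_ge0.
(* Each observed busy time lies between 0 and its own initial value plus [t], so the difference is
   at most the sum of both initial values plus [t]. *)
move=> w rw Aw; split.
  apply: (ge0_ler_powR p0); rewrite ?nnegrE ?addr_ge0//.
  have := observed_busy_bounds C mu t0 (valid ^~ w) 0.
  have := observed_busy_bounds C mu t0 (valid ^~ w) 1.
  have := X0 0 w; have := X0 1 w; rewrite ler_norml; lra.
move=> E; have [s hs] := observed_busy_drained rw mu0 t0 Aw (valid ^~ w).
by rewrite !hs// subrr normr0 powR0.
Qed.
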